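(* Let $R\subseteq\mathbb{Z}^{\mathbf{x}}\times\mathbb{Z}^{\mathbf{x}}$ be a finite monoid affine relation. Then its weakest non-termination precondition $\mathrm{wnt}(R)$ is definable in Presburger arithmetic, and a Presburger formula defining it is effectively computable from (the formula defining) $R$. Consequently, the termination problem (given $R$, decide whether $\mathrm{wnt}(R)=\emptyset$) is decidable for finite monoid affine relations.
   Context: $\mathbf{x}=\langle x_1,\dots,x_N\rangle$ are integer variables, $\mathbf{x}'$ primed copies, $\mathbb{Z}^{\mathbf{x}}$ the set of valuations $\mathbf{x}\to\mathbb{Z}$. An affine relation is a relation on $\mathbb{Z}^{\mathbf{x}}$ defined by a formula $R(\mathbf{x},\mathbf{x}')\iff\mathbf{x}'=A\mathbf{x}+\mathbf{b}\wedge\varphi(\mathbf{x})$, where $A\in\mathbb{Z}^{N\times N}$, $\mathbf{b}\in\mathbb{Z}^N$ and $\varphi$ (the guard) is a quantifier-free Presburger formula over unprimed variables only. It is a finite monoid affine relation if the set of powers $\{A^i\mid i\ge0\}$ is finite (with $A^0$ the identity matrix). $\mathrm{wnt}(R)$ is the set of valuations $\nu\in\mathbb{Z}^{\mathbf{x}}$ for which there is an infinite sequence $\nu=\nu_0,\nu_1,\nu_2,\dots$ with $(\nu_i,\nu_{i+1})\in R$ for all $i\ge0$. Presburger arithmetic is first-order logic over the integers with atoms $t\le0$, $t$ a linear term with integer coefficients. *)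

(* Defs.v *)
From mathcomp Require Import all_boot all_order all_algebra.
From mathcomp Require Import boolp classical_sets functions cardinality.

Set Implicit Arguments.
Unset Strict Implicit.
Unset Printing Implicit Defensive.

Import GRing.Theory.

Local Open Scope ring_scope.
Local Open Scope classical_set_scope.

Record lterm (n : nat) := LTerm { coef : 'rV[int]_n; cst : int }.

Definition lterm_val n (t : lterm n) (v : 'cV[int]_n) : int :=
  \sum_(i < n) coef t 0 i * v i 0 + cst t.

(** Well-scoped de Bruijn formulas: the free variables of [f : pform n] are
    among [x_0, ..., x_(n-1)]; a quantifier binds variable [0] of its body and
    shifts the other variables by one. *)
Inductive pform : nat -> Type :=
| PLe0 n (t : lterm n) : pform n
| PNot n (f : pform n) : pform n
| PAnd n (f g : pform n) : pform n
| POr n (f g : pform n) : pform n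
| PEx n (f : pform n.+1) : pform n
| PAll n (f : pform n.+1) : pform n.

Definition vcons n (z : int) (v : 'cV[int]_n) : 'cV[int]_n.+1 :=
  col_mx (const_mx z : 'cV_1) v.

Fixpoint sat n (f : pform n) : 'cV[int]_n -> Prop :=
  match f in pform n return 'cV[int]_n -> Prop with
  | PLe0 _ t => fun v => lterm_val t v <= 0
  | PNot _ f => fun v => ~ sat f v
  | PAnd _ f g => fun v => sat f v /\ sat g v
  | POr _ f g => fun v => sat f v \/ sat g v
  | PEx _ f => fun v => exists z : int, sat f (vcons z v)
  | PAll _ f => fun v => forall z : int, sat f (vcons z v)
  end.

Fixpoint qfree n (f : pform n) : bool :=
  match f with
  | PLe0 _ _ => true
  | PNot _ f => qfree f
  | PAnd _ f g | POr _ f g => qfree f && qfree g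
  | PEx _ _ | PAll _ _ => false
  end.

Definition defines n (f : pform n) (S : set 'cV[int]_n) : Prop :=
  S = [set v | sat f v].

Record affine (N : nat) := Affine {
  amat : 'M[int]_N;
  avec : 'cV[int]_N;
  guard : pform N;
  guard_qfree : qfree guard }.

Definition arel N (R : affine N) (x x' : 'cV[int]_N) : Prop :=
  x' = amat R *m x + avec R /\ sat (guard R) x.

Definition finite_monoid N (R : affine N) : Prop :=
  finite_set (range (fun i : nat => amat R ^+ i)).

Definition wnt N (R : affine N) : set 'cV[int]_N :=
  [set v | exists u : nat -> 'cV[int]_N,
     u 0%N = v /\ forall i, arel R (u i) (u i.+1)].

Inductive recfun : nat -> Type :=
| RZero n : recfun n
| RSucc : recfun 1
| RProj n (i : 'I_n) : recfun n
| RComp m n (f : recfun m) (g : 'I_m -> recfun n) : recfun n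
| RPrec n (f : recfun n) (g : recfun n.+2) : recfun n.+1
| RMin n (f : recfun n.+1) : recfun n.

(** [computes p v y]: the computation of [p] on the arguments [v] halts with
    value [y].  Composition is strict; [RPrec] recurses on its first argument
    ([h (0, v) = f v], [h (k+1, v) = g (k, h (k, v), v)]); [RMin f] at [v] is
    the least [y] with [f (y, v) = 0], all smaller values of [f] being defined
    and nonzero. *)
Fixpoint computes n (p : recfun n) : n.-tuple nat -> nat -> Prop :=
  match p in recfun n return n.-tuple nat -> nat -> Prop with
  | RZero _ => fun _ y => y = 0%N
  | RSucc => fun v y => y = (thead v).+1
  | RProj _ i => fun v y => y = tnth v i
  | RComp m _ f g => fun v y =>
      exists w : m.-tuple nat,
        (forall i, computes (g i) v (tnth w i)) /\ computes f w y
  | RPrec _ f g => fun v y =>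
      exists h : nat -> nat,
        [/\ computes f [tuple of behead v] (h 0%N),
            forall k, (k < thead v)%N ->
              computes g [tuple of k :: h k :: behead v] (h k.+1)
          & y = h (thead v)]
  | RMin _ f => fun v y =>
      computes f [tuple of y :: v] 0%N /\
      forall k, (k < y)%N -> exists z, computes f [tuple of k :: v] z.+1
  end.

(** Cantor's pairing function. *)
Definition code_pair (a b : nat) : nat := ('C((a + b).+1, 2) + b)%N.

Definition code_seq (s : seq nat) : nat :=
  foldr (fun a c => (code_pair a c).+1) 0%N s.

Definition code_int (z : int) : nat :=
  match z with Posz n => n.*2 | Negz n => n.*2.+1 end.

Definition code_mx m n (M : 'M[int]_(m, n)) : nat :=
  code_seq [seq code_seq [seq code_int (M i j) | j <- enum 'I_n]
           | i <- enum 'I_m].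

(** The scope [n] is not part of the code of a formula: it is the dimension
    [N] recorded in [code_affine]. *)
Fixpoint code_pform n (f : pform n) : nat :=
  match f with
  | PLe0 _ t => code_seq [:: 0; code_mx (coef t); code_int (cst t)]%N
  | PNot _ f => code_seq [:: 1; code_pform f]%N
  | PAnd _ f g => code_seq [:: 2; code_pform f; code_pform g]%N
  | POr _ f g => code_seq [:: 3; code_pform f; code_pform g]%N
  | PEx _ f => code_seq [:: 4; code_pform f]%N
  | PAll _ f => code_seq [:: 5; code_pform f]%N
  end.

Definition code_affine N (R : affine N) : nat :=
  code_seq [:: N; code_mx (amat R); code_mx (avec R); code_pform (guard R)].

(* Main.v *)
(** Since the powers of [A] form a finite set, [A^(2m) = A^m] for some [m > 0].
    Let [u_n] be the [n]-th iterate of [x |-> A x + b] and [s = u_m(0)]; then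
    [u_(m+mk)(v) = u_m(v + k s)], so [wnt R] is the set of the [v] such that the
    guard holds at [u_n(v)] for [n <= m] and, for every [k >= 0], at
    [u_n(u_m(v + k s))] for [n <= m].  As the guard is quantifier free, this is a
    Presburger formula, obtained from [R] and [m] by substitutions.

    Emptiness is decided by a small model property, proved by an
    Ehrenfeucht-Fraisse argument: two vectors are equivalent at precision [M] if
    linear forms with coefficients at most [M] have the same sign on both and if
    they are congruent modulo [M!].  Equivalence at precision [nxt M] allows
    any additional coordinate on one side to be matched by one of bounded size on
    the other side, at precision [M].  Hence both the existential quantifiers on
    [v] and the universal one on [k] can be restricted to computable ranges.

    Everything but the search for [m] is a total function on codes, so
    computability amounts to closure properties of a class of total functions
    containing course-of-values recursion over the code of a formula. *)
Require Import Defs.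
From mathcomp Require Import all_boot all_order all_algebra.
From mathcomp Require Import boolp classical_sets functions cardinality.
From mathcomp Require Import zify ring.

Set Implicit Arguments.
Unset Strict Implicit.
Unset Printing Implicit Defensive.

Import Defs Order.TTheory GRing.Theory Num.Theory.

(** * Computable functions *)

Definition tri (n : nat) : nat := 'C(n.+1, 2).

Lemma triS n : tri n.+1 = tri n + n.+1.
Proof. by rewrite /tri binS bin1. Qed.

Lemma leq_tri m n : m <= n -> tri m <= tri n.
Proof. by move=> le_mn; rewrite /tri leq_bin2l. Qed.

(** The greatest [d] with [tri d <= x], that is, the index of the antidiagonal through [x]. It grows
    by at most one when [x] does, so plain recursion computes it and unpairing needs no search. *)
Fixpoint diag (x : nat) : nat :=
  if x is y.+1 then diag y + (tri (diag y).+1 <= y.+1) else 0.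

Lemma diagP x : tri (diag x) <= x < tri (diag x).+1.
Proof.
elim: x => [|x /andP[le1 lt1]] //=.
case: (leqP (tri (diag x).+1) x.+1) => h; rewrite ?addn1 ?addn0.
  by rewrite h /= triS; lia.
by rewrite h andbT; lia.
Qed.

Definition unpair2 (x : nat) : nat := x - tri (diag x).
Definition unpair1 (x : nat) : nat := diag x - unpair2 x.

Lemma diag_pair a b : diag (code_pair a b) = a + b.
Proof.
have /andP[h1 h2] := diagP (code_pair a b).
have e : code_pair a b = tri (a + b) + b by [].
have e2 := triS (a + b).
case: (ltngtP (diag (code_pair a b)) (a + b)) => // h.
- by have := leq_tri h; lia.
- by have := leq_tri h; lia.
Qed.

Lemma unpair2_pair a b : unpair2 (code_pair a b) = b.
Proof. by rewrite /unpair2 diag_pair /code_pair -/(tri _) addKn. Qed.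

Lemma unpair1_pair a b : unpair1 (code_pair a b) = a.
Proof. by rewrite /unpair1 unpair2_pair diag_pair addnK. Qed.

Lemma pair_unpair x : code_pair (unpair1 x) (unpair2 x) = x.
Proof.
have /andP[h1 h2] := diagP x; move: h2; rewrite triS => h2.
have h3 : unpair2 x <= diag x by rewrite /unpair2; lia.
by rewrite /code_pair -/(tri _) /unpair1 subnK // /unpair2 subnKC.
Qed.

Lemma leq_pairl a b : a <= code_pair a b.
Proof.
rewrite /code_pair -/(tri _); suff h n : n <= tri n by have := h (a + b); lia.
by elim: n => // n; rewrite triS; lia.
Qed.

Lemma leq_pairr a b : b <= code_pair a b.
Proof. by rewrite /code_pair leq_addl. Qed.

Lemma leq_pair a b a' b' : a <= a' -> b <= b' -> code_pair a b <= code_pair a' b'.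
Proof. by move=> h h'; rewrite leq_add // leq_tri // leq_add. Qed.

(** * Total functions on tuples computed by recursive programs *)

Definition nfun n (f : n.-tuple nat -> nat) : Prop :=
  exists p : recfun n, forall v, computes p v (f v).

Lemma nfun_ext n (f g : n.-tuple nat -> nat) : f =1 g -> nfun f -> nfun g.
Proof. by move=> fg [p hp]; exists p => v; rewrite -fg. Qed.

Lemma nfun_comp m n (f : m.-tuple nat -> nat) (g : 'I_m -> n.-tuple nat -> nat) :
  nfun f -> (forall i, nfun (g i)) -> nfun (fun v => f [tuple g i v | i < m]).
Proof.
move=> [p hp] /choice[q hq]; exists (RComp p q) => v /=.
by exists [tuple g i v | i < m]; split=> // i; rewrite tnth_mktuple.
Qed.

Lemma nfun_proj n i : i < n -> nfun (fun v : n.-tuple nat => nth 0 v i).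
Proof. by move=> lt_in; exists (RProj (Ordinal lt_in)) => v /=; rewrite (tnth_nth 0). Qed.

Lemma nfun_rec n (f : n.-tuple nat -> nat) (g : n.+2.-tuple nat -> nat) :
  nfun f -> nfun g ->
  nfun (fun v : n.+1.-tuple nat =>
    iteri (thead v) (fun k r => g [tuple of k :: r :: behead v])
      (f [tuple of behead v])).
Proof.
move=> [p hp] [q hq]; exists (RPrec p q) => v /=.
by exists (fun k => iteri k (fun k r => g [tuple of k :: r :: behead v])
      (f [tuple of behead v])); split=> /=.
Qed.

Lemma thead_nth n (v : n.+1.-tuple nat) : thead v = nth 0 v 0.
Proof. by rewrite /thead (tnth_nth 0). Qed.

Lemma nth_mktuple0 m (f : 'I_m -> nat) i (lt_im : i < m) :
  nth 0 [tuple f i | i < m] i = f (Ordinal lt_im).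
Proof. by rewrite -(tnth_nth 0 _ (Ordinal lt_im)) tnth_mktuple. Qed.

Definition nfun1 (f : nat -> nat) := nfun (fun v : 1.-tuple nat => f (nth 0 v 0)).
Definition nfun2 (f : nat -> nat -> nat) :=
  nfun (fun v : 2.-tuple nat => f (nth 0 v 0) (nth 0 v 1)).

Lemma nfun1_comp n f (g : n.-tuple nat -> nat) :
  nfun1 f -> nfun g -> nfun (fun v => f (g v)).
Proof.
move=> hf hg; apply: nfun_ext (nfun_comp (g := fun=> g) hf _) => // v.
by rewrite (nth_mktuple0 _ (isT : 0 < 1)).
Qed.

Lemma nfun2_comp n f (g h : n.-tuple nat -> nat) :
  nfun2 f -> nfun g -> nfun h -> nfun (fun v => f (g v) (h v)).
Proof.
move=> hf hg hh.
apply: nfun_ext (nfun_comp (g := fun i : 'I_2 => if i == 0 :> nat then g else h) hf _).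
  by move=> v; rewrite (nth_mktuple0 _ (isT : 0 < 2)) (nth_mktuple0 _ (isT : 1 < 2)).
by move=> i; case: ifP.
Qed.

Lemma nfunS : nfun1 S.
Proof. by exists RSucc => v /=; rewrite thead_nth. Qed.

Lemma nfun_const n c : nfun (fun _ : n.-tuple nat => c).
Proof.
elim: c => [|c ih]; first by exists (RZero n).
exact: nfun1_comp nfunS ih.
Qed.

Lemma nfun1_rec c (g : nat -> nat -> nat) : nfun2 g -> nfun1 (fun k => iteri k g c).
Proof.
move=> hg; have := nfun_rec (nfun_const 0 c) hg.
by apply: nfun_ext => v; rewrite thead_nth.
Qed.

Lemma nfun2_rec (f : nat -> nat) (g : nat -> nat -> nat -> nat) :
  nfun1 f -> nfun (fun v : 3.-tuple nat => g (nth 0 v 2) (nth 0 v 0) (nth 0 v 1)) ->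
  nfun2 (fun k a => iteri k (g a) (f a)).
Proof.
move=> hf hg; have := nfun_rec hf hg.
apply: nfun_ext => v; rewrite thead_nth /=.
by rewrite nth_behead.
Qed.

Lemma nfun2_swap f : nfun2 f -> nfun2 (fun a b => f b a).
Proof. by move=> hf; apply: (nfun2_comp hf); exact: nfun_proj. Qed.

Lemma nfun2_add : nfun2 addn.
Proof.
have h : nfun2 (fun k a => iteri k (fun _ r => r.+1) a).
  apply: (@nfun2_rec id (fun _ _ r => r.+1)); first exact: nfun_proj.
  exact/(nfun1_comp nfunS)/nfun_proj.
by apply: nfun_ext h => v; elim: (nth 0 v 0) => //= k ->.
Qed.

Lemma nfun2_mul : nfun2 muln.
Proof.
have h : nfun2 (fun k a => iteri k (fun _ r => a + r) 0).
  apply: (@nfun2_rec (fun=> 0) (fun a _ r => a + r)); first exact: nfun_const.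
  by apply: (nfun2_comp nfun2_add); exact: nfun_proj.
by apply: nfun_ext h => v; elim: (nth 0 v 0) => //= k ->; rewrite mulSn.
Qed.

Lemma nfun1_pred : nfun1 predn.
Proof.
have h : nfun1 (fun k => iteri k (fun i _ => i) 0) by apply/nfun1_rec/nfun_proj.
by apply: nfun_ext h => v; case: (nth 0 v 0).
Qed.

Lemma nfun2_sub : nfun2 subn.
Proof.
have h : nfun2 (fun k a => iteri k (fun _ r => r.-1) a).
  apply: (@nfun2_rec id (fun _ _ r => r.-1)); first exact: nfun_proj.
  exact/(nfun1_comp nfun1_pred)/nfun_proj.
apply: nfun_ext (nfun2_swap h) => v /=.
by elim: (nth 0 v 1) => /= [|k ->]; rewrite ?subn0 ?subnS.
Qed.

Lemma nfun1_tri : nfun1 tri.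
Proof.
have h : nfun1 (fun k => iteri k (fun i r => r + i.+1) 0).
  apply: nfun1_rec; apply: (nfun2_comp nfun2_add); first exact: nfun_proj.
  exact/(nfun1_comp nfunS)/nfun_proj.
by apply: nfun_ext h => v; elim: (nth 0 v 0) => //= k ->; rewrite triS.
Qed.

Lemma nfun2_pair : nfun2 code_pair.
Proof.
apply: (nfun2_comp nfun2_add); last exact: nfun_proj.
by apply/(nfun1_comp nfun1_tri)/(nfun2_comp nfun2_add); exact: nfun_proj.
Qed.

(** Truncated subtraction turns a comparison into arithmetic. *)
Lemma leq_sub_nat x y : nat_of_bool (x <= y) = 1 - (x - y).
Proof. by case: leqP; lia. Qed.

Lemma nfun2_leq : nfun2 (fun x y => x <= y).
Proof.
suff h : nfun2 (fun x y => 1 - (x - y)).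
  by apply: nfun_ext h => v; rewrite leq_sub_nat.
exact: (nfun2_comp nfun2_sub (nfun_const _ 1) nfun2_sub).
Qed.

Lemma nfun1_diag : nfun1 diag.
Proof.
have h : nfun1 (fun k => iteri k (fun i r => r + (tri r.+1 <= i.+1)) 0).
  apply: nfun1_rec; apply: (nfun2_comp nfun2_add); first exact: nfun_proj.
  apply: (nfun2_comp nfun2_leq); last exact/(nfun1_comp nfunS)/nfun_proj.
  exact/(nfun1_comp nfun1_tri)/(nfun1_comp nfunS)/nfun_proj.
by apply: nfun_ext h => v; elim: (nth 0 v 0) => //= k ->.
Qed.

Lemma nfun1_unpair2 : nfun1 unpair2.
Proof.
apply: (nfun2_comp nfun2_sub); first exact: nfun_proj.
exact: (nfun1_comp nfun1_tri nfun1_diag).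
Qed.

Lemma nfun1_unpair1 : nfun1 unpair1.
Proof. exact: (nfun2_comp nfun2_sub nfun1_diag nfun1_unpair2). Qed.

(** * Computable functions between encoded types *)

Class Enc (T : Type) := enc : T -> nat.
#[global] Hint Mode Enc ! : typeclass_instances.

Instance enc_nat : Enc nat := id.
Instance enc_bool : Enc bool := nat_of_bool.
Instance enc_int : Enc int := code_int.
Instance enc_seq : Enc (seq nat) := code_seq.
Instance enc_prod T U `{Enc T} `{Enc U} : Enc (T * U) :=
  fun x => code_pair (enc x.1) (enc x.2).

(* The realizer [g] is total on [nat], so that it can be iterated without
   knowing that the intermediate values are codes. *)
Variant computable X Y `{Enc X} `{Enc Y} (f : X -> Y) : Prop :=
  Computable g of nfun1 g & forall x, g (enc x) = enc (f x).

Section Comp.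
Context (X : Type) {eX : Enc X}.

Lemma comp_ext Y {eY : Enc Y} (f g : X -> Y) : f =1 g -> computable f -> computable g.
Proof. by move=> fg [h hh hf]; exists h => // x; rewrite hf fg. Qed.

Lemma comp_id : computable (fun x : X => x).
Proof. by exists id => //; exact: nfun_proj. Qed.

Lemma comp_const Y {eY : Enc Y} (c : Y) : computable (fun _ : X => c).
Proof. by exists (fun=> enc c) => //; exact: nfun_const. Qed.

Lemma comp_comp Y {eY : Enc Y} Z {eZ : Enc Z} (f : Y -> Z) (g : X -> Y) :
  computable f -> computable g -> computable (fun x => f (g x)).
Proof.
move=> [f' cf hf] [g' cg hg]; exists (f' \o g') => [|x /=]; last by rewrite hg hf.
exact: (nfun1_comp cf cg).
Qed.

Lemma comp_pair Y {eY : Enc Y} Z {eZ : Enc Z} (f : X -> Y) (g : X -> Z) :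
  computable f -> computable g -> computable (fun x => (f x, g x)).
Proof.
move=> [f' cf hf] [g' cg hg].
exists (fun n => code_pair (f' n) (g' n)) => [|x]; last by rewrite hg hf.
exact: (nfun2_comp nfun2_pair cf cg).
Qed.

Lemma comp_fst Y {eY : Enc Y} Z {eZ : Enc Z} (f : X -> Y * Z) :
  computable f -> computable (fun x => (f x).1).
Proof.
move=> [f' cf hf]; exists (unpair1 \o f') => [|x /=]; last by rewrite hf unpair1_pair.
exact: (nfun1_comp nfun1_unpair1 cf).
Qed.

Lemma comp_snd Y {eY : Enc Y} Z {eZ : Enc Z} (f : X -> Y * Z) :
  computable f -> computable (fun x => (f x).2).
Proof.
move=> [f' cf hf]; exists (unpair2 \o f') => [|x /=]; last by rewrite hf unpair2_pair.
exact: (nfun1_comp nfun1_unpair2 cf).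
Qed.

Lemma comp_nfun1 (h : nat -> nat) (f : X -> nat) :
  nfun1 h -> computable f -> computable (fun x => h (f x)).
Proof.
move=> ch [f' cf hf]; exists (h \o f') => [|x /=]; last by rewrite hf.
exact: (nfun1_comp ch cf).
Qed.

Lemma comp_nfun2 (h : nat -> nat -> nat) (f g : X -> nat) :
  nfun2 h -> computable f -> computable g -> computable (fun x => h (f x) (g x)).
Proof.
move=> ch [f' cf hf] [g' cg hg].
exists (fun n => h (f' n) (g' n)) => [|x]; last by rewrite hg hf.
exact: (nfun2_comp ch cf cg).
Qed.

Lemma comp_S (f : X -> nat) : computable f -> computable (fun x => (f x).+1).
Proof. exact: comp_nfun1 nfunS. Qed.

Lemma comp_add (f g : X -> nat) :
  computable f -> computable g -> computable (fun x => f x + g x).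
Proof. exact: comp_nfun2 nfun2_add. Qed.

Lemma comp_sub (f g : X -> nat) :
  computable f -> computable g -> computable (fun x => f x - g x).
Proof. exact: comp_nfun2 nfun2_sub. Qed.

Lemma comp_mul (f g : X -> nat) :
  computable f -> computable g -> computable (fun x => f x * g x).
Proof. exact: comp_nfun2 nfun2_mul. Qed.

Lemma comp_code_pair (f g : X -> nat) :
  computable f -> computable g -> computable (fun x => code_pair (f x) (g x)).
Proof. exact: comp_nfun2 nfun2_pair. Qed.

Lemma comp_leq (f g : X -> nat) :
  computable f -> computable g -> computable (fun x => f x <= g x).
Proof.
move=> cf cg; have [h ch hh] := comp_nfun2 nfun2_leq cf cg.
by exists h.
Qed.

Lemma comp_if Y {eY : Enc Y} (b : X -> bool) (f g : X -> Y) :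
  computable b -> computable f -> computable g ->
  computable (fun x => if b x then f x else g x).
Proof.
move=> [b' cb hb] [f' cf hf] [g' cg hg].
(* Branching as arithmetic: [b'] is [0] or [1] on codes, and both branches have total realizers. *)
exists (fun n => b' n * f' n + (1 - b' n) * g' n) => [|x].
  apply: (nfun2_comp nfun2_add); apply: (nfun2_comp nfun2_mul) => //.
  exact: (nfun2_comp nfun2_sub (nfun_const _ _)).
rewrite hb hf hg /enc /enc_bool; case: (b x); rewrite ?mul1n ?mul0n ?addn0 //.
Qed.

Lemma comp_neg (f : X -> bool) : computable f -> computable (fun x => ~~ f x).
Proof. by move=> cf; apply: (comp_if cf); exact: comp_const. Qed.

Lemma comp_and (f g : X -> bool) :
  computable f -> computable g -> computable (fun x => f x && g x).
Proof. by move=> cf cg; apply: (comp_if cf cg); exact: comp_const. Qed.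

Lemma comp_or (f g : X -> bool) :
  computable f -> computable g -> computable (fun x => f x || g x).
Proof. by move=> cf cg; apply: (comp_if cf _ cg); exact: comp_const. Qed.

Lemma comp_eqn (f g : X -> nat) :
  computable f -> computable g -> computable (fun x => f x == g x).
Proof.
move=> cf cg; apply: comp_ext (comp_and (comp_leq cf cg) (comp_leq cg cf)) => x.
by rewrite eqn_leq.
Qed.

Lemma comp_iteri Y {eY : Enc Y} (n : X -> nat) (F : X -> nat -> Y -> Y) (a : X -> Y) :
  computable n -> computable (fun z : X * nat * Y => F z.1.1 z.1.2 z.2) -> computable a ->
  computable (fun x => iteri (n x) (F x) (a x)).
Proof.
move=> [n' cn hn] [F' cF hF] [a' ca ha].
exists (fun c => iteri (n' c) (fun k r => F' (code_pair (code_pair c k) r)) (a' c)).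
  have h := nfun2_rec (g := fun c k r => F' (code_pair (code_pair c k) r)) ca _.
  apply: (nfun2_comp (h _) cn); last exact: nfun_proj.
  apply/(nfun1_comp cF)/(nfun2_comp nfun2_pair); last exact: nfun_proj.
  by apply: (nfun2_comp nfun2_pair); exact: nfun_proj.
move=> x; rewrite hn ha -[enc (n x)]/(n x); elim: (n x) => //= k ->.
exact: (hF (x, k, _)).
Qed.

End Comp.

Lemma comp_iter X {eX : Enc X} Y {eY : Enc Y}
    (n : X -> nat) (F : X -> Y -> Y) (a : X -> Y) :
  computable n -> computable (fun z : X * Y => F z.1 z.2) -> computable a ->
  computable (fun x => iter (n x) (F x) (a x)).
Proof.
move=> cn cF ca.
have c : computable (fun z : X * nat * Y => (z.1.1, z.2)).
  apply: comp_pair; last exact/comp_snd/comp_id.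
  exact/comp_fst/comp_fst/comp_id.
apply: comp_ext (comp_iteri cn (F := fun x _ => F x) (comp_comp cF c) ca) => x.
by elim: (n x) => //= k ->.
Qed.

Lemma comp_nat (f : nat -> nat) : computable f -> nfun1 f.
Proof. by move=> [g cg hg]; apply: nfun_ext cg => v; exact: hg. Qed.

(** A change of type that preserves codes costs nothing. This is how booleans, integers and
    sequences are exchanged with numbers. *)
Lemma comp_recode X {eX : Enc X} Y {eY : Enc Y} Z {eZ : Enc Z} (f : X -> Y) (h : Y -> Z) :
  computable f -> (forall y, enc (h y) = enc y) -> computable (fun x => h (f x)).
Proof. by move=> [g cg hg] eh; exists g => // x; rewrite hg eh. Qed.

Lemma comp_ctx2 X {eX : Enc X} Y {eY : Enc Y} Z {eZ : Enc Z} T {eT : Enc T}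
    (F : Y -> Z -> T) (u : X -> Y) (w : X -> Z) :
  computable (fun z : Y * Z => F z.1 z.2) -> computable u -> computable w ->
  computable (fun x => F (u x) (w x)).
Proof. by move=> cF cu cw; exact: (comp_comp cF (comp_pair cu cw)). Qed.

(** One closure property per head symbol of the function body. Hypotheses come before the arithmetic
    operations, so abstract computable functions may occur inside terms. [comp_solve] is redefined
    below as new operations become available. *)
Ltac comp_step := match goal with
  | |- computable (fun x => x) => apply comp_id
  | |- computable fst => refine (comp_fst (@comp_id _ _))
  | |- computable snd => refine (comp_snd (@comp_id _ _))
  | |- computable (fun _ => ?c) => apply (comp_const c)
  | H : computable ?f |- computable ?f => exact H
  | H : computable (fun z => ?F z.1 z.2) |- computable (fun x => ?F (@?u x) (@?w x)) =>
      apply (comp_ctx2 (u := u) (w := w) H)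
  | H : computable ?f |- computable (fun x => ?f (@?u x)) =>
      apply (comp_comp (g := u) H)
  | |- computable (fun x => (@?f x, @?g x)) => apply (comp_pair (f := f) (g := g))
  | |- computable (fun x => fst (@?f x)) => apply (comp_fst (f := f))
  | |- computable (fun x => snd (@?f x)) => apply (comp_snd (f := f))
  | |- computable (fun x => (@?f x).+1) => apply (comp_S (f := f))
  | |- computable (fun x => (@?f x).-1) => apply (comp_nfun1 (f := f) nfun1_pred)
  | |- computable (fun x => unpair1 (@?f x)) => apply (comp_nfun1 (f := f) nfun1_unpair1)
  | |- computable (fun x => unpair2 (@?f x)) => apply (comp_nfun1 (f := f) nfun1_unpair2)
  | |- computable (fun x => @?f x + @?g x) => apply (comp_add (f := f) (g := g))
  | |- computable (fun x => @?f x - @?g x) => apply (comp_sub (f := f) (g := g))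
  | |- computable (fun x => @?f x * @?g x) => apply (comp_mul (f := f) (g := g))
  | |- computable (fun x => code_pair (@?f x) (@?g x)) =>
      apply (comp_code_pair (f := f) (g := g))
  | |- computable (fun x => @?f x <= @?g x) => apply (comp_leq (f := f) (g := g))
  | |- computable (fun x => @?f x == @?g x) => apply (comp_eqn (f := f) (g := g))
  | |- computable (fun x => ~~ (@?f x)) => apply (comp_neg (f := f))
  | |- computable (fun x => (@?f x) && (@?g x)) => apply (comp_and (f := f) (g := g))
  | |- computable (fun x => (@?f x) || (@?g x)) => apply (comp_or (f := f) (g := g))
  | |- computable (fun x => iter (@?n x) (@?F x) (@?a x)) =>
      apply (comp_iter (n := n) (F := F) (a := a))
  | |- computable (fun x => iteri (@?n x) (@?F x) (@?a x)) =>
      apply (comp_iteri (n := n) (F := F) (a := a))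
  | |- computable (fun _ => if _ then _ else _) => refine (comp_if _ _ _)
  end.

Ltac comp_solve := repeat (comp_step; cbv beta).

Lemma comp_bool_nat X {eX : Enc X} (b : X -> bool) :
  computable b -> computable (fun x => nat_of_bool (b x)).
Proof. by move=> cb; exact: (comp_recode cb). Qed.

Lemma comp_odd X {eX : Enc X} (f : X -> nat) :
  computable f -> computable (fun x => odd (f x)).
Proof.
move=> cf; have c : computable (fun x : X => iter (f x) negb false) by comp_solve.
by apply: comp_ext c => x; elim: (f x) => //= k ->.
Qed.

(** [n./2] is the number of odd integers below [n]. *)
Lemma comp_half X {eX : Enc X} (f : X -> nat) :
  computable f -> computable (fun x => (f x)./2).
Proof.
move=> cf; have c : computable (fun x : X => iteri (f x) (fun i r => r + odd i) 0).
  comp_solve; apply/comp_bool_nat/comp_odd; comp_solve.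
by apply: comp_ext c => x; elim: (f x) => //= k ->; rewrite uphalf_half addnC.
Qed.

(** * Computable integer arithmetic *)

Definition ipos (z : int) : nat := if z is Posz n then n else 0.
Definition ineg (z : int) : nat := if z is Negz n then n.+1 else 0.

Lemma ipos_ineg z : (z = (ipos z)%:Z - (ineg z)%:Z)%R.
Proof. by case: z => n /=; lia. Qed.

Lemma comp_ipos X {eX : Enc X} (f : X -> int) :
  computable f -> computable (fun x => ipos (f x)).
Proof.
move=> cf.
have c : computable (fun c : nat => if odd c then 0 else c./2).
  by comp_solve; [apply: comp_odd | apply: comp_half]; comp_solve.
have [g cg hg] := cf; exists (fun n => if odd (g n) then 0 else (g n)./2).
  exact: (nfun1_comp (comp_nat c) cg).
move=> x; rewrite hg; case: (f x) => n /=; rewrite /enc /enc_int /enc_nat /= odd_double //.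
by rewrite doubleK.
Qed.

Lemma comp_ineg X {eX : Enc X} (f : X -> int) :
  computable f -> computable (fun x => ineg (f x)).
Proof.
move=> cf.
have c : computable (fun c : nat => if odd c then c./2.+1 else 0).
  by comp_solve; [apply: comp_odd | apply: comp_half]; comp_solve.
have [g cg hg] := cf; exists (fun n => if odd (g n) then (g n)./2.+1 else 0).
  exact: (nfun1_comp (comp_nat c) cg).
move=> x; rewrite hg; case: (f x) => n /=; rewrite /enc /enc_int /enc_nat /= odd_double //.
by rewrite /= uphalf_double.
Qed.

(** Sums and products of integers reduce to this case: they are computed on positive and negative
    parts, then recombined as one difference of naturals. *)
Lemma comp_subz X {eX : Enc X} (f g : X -> nat) :
  computable f -> computable g -> computable (fun x => ((f x)%:Z - (g x)%:Z)%R : int).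
Proof.
move=> cf cg.
have [h ch hh] : computable (fun x : X => if g x <= f x then 2 * (f x - g x)
                                else (2 * (g x - (f x).+1)).+1).
  by comp_solve.
exists h => // x; rewrite hh /enc /enc_nat /enc_int; case: leqP => le_gf.
  by rewrite (_ : (_ - _)%R = Posz (f x - g x)) /= ?mul2n //; lia.
by rewrite (_ : (_ - _)%R = Negz (g x - (f x).+1)) /= ?mul2n //; lia.
Qed.

Lemma comp_Posz X {eX : Enc X} (f : X -> nat) :
  computable f -> computable (fun x => Posz (f x)).
Proof.
move=> cf; apply: comp_ext (comp_subz cf (comp_const 0)) => x.
by rewrite subr0.
Qed.

Lemma comp_addz X {eX : Enc X} (f g : X -> int) :
  computable f -> computable g -> computable (fun x => (f x + g x)%R : int).
Proof.
move=> cf cg.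
have c := comp_subz (comp_add (comp_ipos cf) (comp_ipos cg))
                    (comp_add (comp_ineg cf) (comp_ineg cg)).
apply: comp_ext c => x.
by rewrite [in RHS](ipos_ineg (f x)) [in RHS](ipos_ineg (g x)); lia.
Qed.

Lemma comp_mulz X {eX : Enc X} (f g : X -> int) :
  computable f -> computable g -> computable (fun x => (f x * g x)%R : int).
Proof.
move=> cf cg; have [cf1 cf2 cg1 cg2] :=
  And4 (comp_ipos cf) (comp_ineg cf) (comp_ipos cg) (comp_ineg cg).
have c := comp_subz (comp_add (comp_mul cf1 cg1) (comp_mul cf2 cg2))
                    (comp_add (comp_mul cf1 cg2) (comp_mul cf2 cg1)).
apply: comp_ext c => x.
by rewrite [in RHS](ipos_ineg (f x)) [in RHS](ipos_ineg (g x)); lia.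
Qed.

Lemma comp_le0z X {eX : Enc X} (f : X -> int) :
  computable f -> computable (fun x => f x <= 0)%R.
Proof.
move=> cf; apply: comp_ext (comp_eqn (comp_ipos cf) (comp_const 0)) => x.
by case: (f x) => n; [case: n | ].
Qed.

(** [code_int] is a bijection, so decoding is total and is realized by the identity on codes. *)
Definition dint (c : nat) : int := if odd c then Negz c./2 else Posz c./2.

Lemma code_intK : cancel code_int dint.
Proof. by case=> n; rewrite /dint /= odd_double ?doubleK //= uphalf_double. Qed.

Lemma dintK : cancel dint code_int.
Proof.
by move=> c; rewrite /dint -[RHS]odd_double_half; case: (odd c).
Qed.

Lemma leq_dint c : (`|dint c| <= c)%N.
Proof.
by have := odd_double_half c; rewrite /dint; case: (odd c) => /=; lia.
Qed.

Lemma comp_dint X {eX : Enc X} (f : X -> nat) :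
  computable f -> computable (fun x => dint (f x)).
Proof. by move=> cf; apply: (comp_recode cf); exact: dintK. Qed.

Lemma comp_code_int X {eX : Enc X} (f : X -> int) :
  computable f -> computable (fun x => code_int (f x)).
Proof. by move=> cf; exact: (comp_recode cf). Qed.

Lemma comp_sum X {eX : Enc X} (n : X -> nat) (F : X -> nat -> int) :
  computable n -> computable (fun z : X * nat => F z.1 z.2) ->
  computable (fun x => (\sum_(0 <= i < n x) F x i)%R : int).
Proof.
move=> cn cF; have c : computable (fun x : X =>
    iteri (n x) (fun i (r : int) => (r + F x i)%R : int) (Posz 0)).
  by comp_solve; apply: comp_addz; comp_solve.
apply: comp_ext c => x; elim: (n x) => [|k ih] /=; first by rewrite big_nil.
by rewrite ih big_nat_recr.
Qed.

(** * Sequences and recursion on trees *)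

Fixpoint dseq_rec (k x : nat) : seq nat :=
  match k, x with
  | k'.+1, y.+1 => unpair1 y :: dseq_rec k' (unpair2 y)
  | _, _ => [::]
  end.

(** The fuel [x] suffices because [unpair2 y <= y], so the argument decreases strictly along the
    tail. *)
Definition dseq (x : nat) : seq nat := dseq_rec x x.

Lemma leq_unpair2 x : unpair2 x <= x.
Proof. by rewrite -{2}[x]pair_unpair leq_pairr. Qed.

Lemma dseqK : cancel dseq code_seq.
Proof.
suff h k x : x <= k -> code_seq (dseq_rec k x) = x by move=> x; exact: h.
elim: k x => [|k ih] [|x] //= le_xk.
by rewrite ih ?pair_unpair // (leq_trans (leq_unpair2 x)).
Qed.

Lemma code_seqK : cancel code_seq dseq.
Proof.
(* Given the other cancellation, injectivity of the coding is enough. *)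
move=> s; suff inj : injective code_seq by apply: inj; rewrite dseqK.
elim=> [|a t ih] [|b u] //= [e].
congr (_ :: _); first by rewrite -(unpair1_pair a (code_seq t)) e unpair1_pair.
by apply: ih; rewrite -(unpair2_pair a (code_seq t)) e unpair2_pair.
Qed.

(** On the code of a formula, index [0] gives the constructor tag and the later ones the codes of
    its arguments. *)
Definition kid (t i : nat) : nat := nth 0 (dseq t) i.

Lemma kid_code s i : kid (code_seq s) i = nth 0 s i.
Proof. by rewrite /kid code_seqK. Qed.

Lemma leq_nth_code s i : nth 0 s i <= (code_seq s).-1.
Proof.
elim: s i => [|a s ih] [|i] //=; first exact: leq_pairl.
by apply: leq_trans (leq_pairr a _); apply: leq_trans (ih i) (leq_pred _).
Qed.

Lemma leq_kid t i : kid t i <= t.-1.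
Proof. by rewrite -{2}[t]dseqK leq_nth_code. Qed.

Lemma comp_nth X {eX : Enc X} (s : X -> seq nat) (i : X -> nat) :
  computable s -> computable i -> computable (fun x => nth 0 (s x) (i x)).
Proof.
move=> [s' cs hs] [i' ci hi].
have c : computable (fun z : nat * nat =>
    unpair1 (iter z.2 (fun c => unpair2 c.-1) z.1).-1).
  by comp_solve.
have cs' : computable s' by exists s'.
have ci' : computable i' by exists i'.
(* Dropping a head from the empty sequence, coded by [0], gives [0] again, and [unpair1] of it is
   [0]: out of range this agrees with the default of [nth]. *)
exists (fun n => unpair1 (iter (i' n) (fun c => unpair2 c.-1) (s' n)).-1).
  by apply: comp_nat; exact: (comp_comp c (comp_pair cs' ci')).
move=> x; rewrite hs hi /enc /enc_nat /enc_seq.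
elim: (i x) (s x) => [|k ih] [|a t] //; rewrite ?iterSr.
- by rewrite /= unpair1_pair.
- by have := ih [::]; rewrite !nth_nil.
- by rewrite -[RHS]ih /= unpair2_pair.
Qed.

Lemma comp_cons X {eX : Enc X} (a : X -> nat) (s : X -> seq nat) :
  computable a -> computable s -> computable (fun x => a x :: s x).
Proof.
move=> ca [g cg hg].
have cg' : computable g by exists g.
have [f cf hf] := ca.
exists (fun n => (code_pair (f n) (g n)).+1) => [|x]; last by rewrite hf hg.
exact: (nfun1_comp nfunS (nfun2_comp nfun2_pair cf cg)).
Qed.

Lemma comp_mkseq X {eX : Enc X} (n : X -> nat) (F : X -> nat -> nat) :
  computable n -> computable (fun z : X * nat => F z.1 z.2) ->
  computable (fun x => mkseq (F x) (n x)).
Proof.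
move=> cn cF.
have c : computable (fun x : X =>
    (* Consing builds the sequence from its last entry, hence the reversed index. *)
    iteri (n x) (fun i s => F x (n x - i.+1) :: s) [::]).
  by comp_solve; apply: comp_cons; comp_solve.
apply: comp_ext c => x.
suff h k m : m + k = n x ->
    iteri k (fun i s => F x (n x - i.+1) :: s) [::] = map (F x) (iota m k).
  exact: (h (n x) 0).
elim: k m => [|k ih] m //= e.
rewrite (ih m.+1); last by rewrite addSn -addnS.
by rewrite -e addnK.
Qed.

Lemma comp_code_seq X {eX : Enc X} (f : X -> seq nat) :
  computable f -> computable (fun x => code_seq (f x)).
Proof. by move=> cf; exact: (comp_recode cf). Qed.

Lemma comp_kid X {eX : Enc X} (t i : X -> nat) :
  computable t -> computable i -> computable (fun x => kid (t x) (i x)).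
Proof.
move=> ct ci; apply: (comp_nth _ ci).
by apply: (comp_recode ct); exact: dseqK.
Qed.

(* Course-of-values recursion along [t], [kid t 1] and [kid t 2], which is
   recursion on formulas. *)
Lemma comp_tree_rec X {eX : Enc X} (h : X -> nat -> nat -> nat -> nat) :
  computable (fun z : X * nat * nat * nat => h z.1.1.1 z.1.1.2 z.1.2 z.2) ->
  exists V : X -> nat -> nat, computable (fun z : X * nat => V z.1 z.2) /\
    forall x t, 0 < t -> V x t = h x t (V x (kid t 1)) (V x (kid t 2)).
Proof.
move=> ch.
(* After [k] steps the history lists the values at [k - 1], ..., [0] in this order, so the value at
   [c < k] sits at position [k - (c + 1)]. *)
pose step x k s := h x k (nth 0 s (k - (kid k 1).+1)) (nth 0 s (k - (kid k 2).+1)) :: s.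
pose hist x n := iteri n (step x) [::].
exists (fun x t => nth 0 (hist x t.+1) 0); split.
  rewrite /hist /step; apply: comp_nth; comp_solve.
  apply: comp_cons; comp_solve.
  have ck i : computable (fun z : X * nat * nat * seq nat =>
      nth 0 z.2 (z.1.2 - (kid z.1.2 i).+1)).
    by apply: comp_nth; comp_solve; apply: comp_kid; comp_solve.
  have c := comp_comp ch (comp_pair (comp_pair (comp_pair _ _) (ck 1)) (ck 2)).
  by apply: c; comp_solve.
move=> x t t_gt0.
have hE n c : c < n -> nth 0 (hist x n) (n - c.+1) = nth 0 (hist x c.+1) 0.
  elim: n => // n ih; rewrite ltnS leq_eqVlt => /orP[/eqP->|lt_cn].
    by rewrite subnn.
  by rewrite -ih // subSn.
have lt_kid i : kid t i < t by have := leq_kid t i; lia.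
by rewrite -(hE _ _ (lt_kid 1)) -(hE _ _ (lt_kid 2)).
Qed.

(** * Definability *)

Local Open Scope ring_scope.

Lemma lterm_valE n (t : lterm n) v : lterm_val t v = (coef t *m v) 0 0 + cst t.
Proof. by rewrite /lterm_val mxE. Qed.

Lemma vcons0 n z (v : 'cV[int]_n) : vcons z v 0 0 = z.
Proof. by rewrite /vcons mxE; case: splitP => i // _; rewrite mxE. Qed.

Lemma vconsS n z (v : 'cV[int]_n) i : vcons z v (lift 0 i) 0 = v i 0.
Proof.
rewrite /vcons mxE; case: splitP => j /=; first by rewrite ord1.
by rewrite /bump /= !add1n => -[e]; congr (v _ _); apply: val_inj.
Qed.

(* Junk on quantified formulas: guards are quantifier free. *)
Fixpoint psub n (f : pform n) (k : nat) : 'M[int]_(n, k) -> 'cV[int]_n -> pform k :=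
  match f with
  | PLe0 _ t => fun M s => PLe0 (LTerm (coef t *m M) ((coef t *m s) 0 0 + cst t))
  | PNot _ f => fun M s => PNot (psub f M s)
  | PAnd _ f g => fun M s => PAnd (psub f M s) (psub g M s)
  | POr _ f g => fun M s => POr (psub f M s) (psub g M s)
  | PEx _ _ | PAll _ _ => fun M s => PLe0 (LTerm 0 0)
  end.

Lemma sat_psub n (f : pform n) k (M : 'M_(n, k)) s v :
  qfree f -> sat (psub f M s) v <-> sat f (M *m v + s).
Proof.
elim: f M s => //= {}n.
- move=> t M s _; rewrite !lterm_valE /= mulmxDr mulmxA.
  by rewrite [in X in _ <-> X]mxE addrA.
- by move=> f ih M s qf; rewrite ih.
- by move=> f ihf g ihg M s /andP[qf qg]; rewrite ihf // ihg.
- by move=> f ihf g ihg M s /andP[qf qg]; rewrite ihf // ihg.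
Qed.

Lemma qfree_psub n (f : pform n) k (M : 'M_(n, k)) s : qfree f -> qfree (psub f M s).
Proof.
elim: f M s => //= {}n.
- by move=> f ihf g ihg M s /andP[qf qg]; rewrite ihf ?ihg.
- by move=> f ihf g ihg M s /andP[qf qg]; rewrite ihf ?ihg.
Qed.

(** * Orbits of an affine map and the formula for non-termination *)

Section Orbit.
Variables (N : nat) (A : 'M[int]_N) (b : 'cV[int]_N).

Definition astep (x : 'cV[int]_N) : 'cV[int]_N := A *m x + b.
Definition traj (n : nat) : 'cV[int]_N -> 'cV[int]_N := iter n astep.

Definition shiftf (m : nat) (f : pform N) : pform N := iter m (fun f => psub f A b) f.
(** Nested as in Horner's scheme: [g] at the current point, and the remaining [m] checks after one
    substitution of the affine step. *)
Definition prefixf (m : nat) (g : pform N) : pform N :=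
  iter m (fun f => PAnd g (psub f A b)) g.

Lemma qfree_shiftf m f : qfree f -> qfree (shiftf m f).
Proof. by move=> qf; elim: m => //= m; exact: qfree_psub. Qed.

Lemma qfree_prefixf m g : qfree g -> qfree (prefixf m g).
Proof. by move=> qg; elim: m => //= m ih; rewrite qg qfree_psub. Qed.

Lemma sat_shiftf m f v : qfree f -> sat (shiftf m f) v <-> sat f (traj m v).
Proof.
move=> qf; elim: m v => //= m ih v.
by rewrite sat_psub ?qfree_shiftf // ih -/(astep v) /traj -iterSr.
Qed.

Lemma sat_prefixf m g v :
  qfree g -> sat (prefixf m g) v <-> forall n, (n <= m)%N -> sat g (traj n v).
Proof.
move=> qg; elim: m v => /= [|m ih] v.
  by split=> [sg [|n]|/(_ 0 isT)].
rewrite sat_psub ?qfree_prefixf // -/(astep v) ih; split=> [[sg h] [|n] // le_nm|h].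
  by rewrite /traj iterSr; exact: h.
by split=> [|n le_nm]; [exact: (h 0) | rewrite /traj -iterSr; exact: (h n.+1)].
Qed.

Lemma trajE n v : traj n v = A ^+ n *m v + traj n 0.
Proof.
elim: n => [|n ih]; first by rewrite expr0 mul1mx addr0.
by rewrite /traj !iterS -/(traj n v) -/(traj n 0) ih /astep exprS mulmxDr mulmxA addrA.
Qed.

Variable m : nat.
Hypothesis idem : A ^+ (m + m) = A ^+ m.

(** With [s = traj m 0], both sides equal [A^m v + A^m s + s], since [A^m A^m = A^m]. *)
Lemma traj_double v : traj (m + m) v = traj m (v + traj m 0).
Proof.
rewrite /traj iterD -!/(traj _ _) [traj m v]trajE [LHS]trajE [RHS]trajE.
by rewrite !mulmxDr mulmxA -[A ^+ m *m A ^+ m]/(A ^+ m * A ^+ m) -exprD idem.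
Qed.

Lemma traj_mul k v : traj (m + m * k) v = traj m (v + traj m 0 *+ k).
Proof.
elim: k v => [|k ih] v; first by rewrite muln0 addn0 mulr0n addr0.
rewrite mulnS addnA addnC /traj iterD -!/(traj _ _) traj_double.
by rewrite /traj -iterD -/(traj _ _) addnC ih mulrS addrA.
Qed.

Lemma traj_periodic (P : 'cV[int]_N -> Prop) v : (0 < m)%N ->
  (forall n, P (traj n v)) <->
  (forall n, (n <= m)%N -> P (traj n v)) /\
  (forall k n, (n <= m)%N -> P (traj n (traj m (v + traj m 0 *+ k)))).
Proof.
move=> m_gt0; split=> [h|[h1 h2] n].
  by split=> [n _|k n _] //; rewrite -traj_mul /traj -iterD; exact: h.
have [/h1 //|lt_mn] := leqP n m.
(* Euclidean division of [n - m] by [m]: the first [m + m k] steps are absorbed by a translation of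
   the start, and fewer than [m] steps remain. *)
have e : n = ((n - m) %% m + (m + m * ((n - m) %/ m)))%N.
  by have := divn_eq (n - m) m; lia.
rewrite e /traj iterD -!/(traj _ _) traj_mul; apply: h2.
by rewrite ltnW // ltn_mod.
Qed.

(** The atom [z + 1 <= 0] says that the bound variable is negative; as a disjunct it relativizes the
    universal quantifier to natural numbers. *)
Definition neg_lterm : lterm N.+1 := LTerm (delta_mx 0 0) 1.

(** With [s = traj m 0], the block matrix [[s | 1]] sends [(k, v)] to [v + k s], variable [0] being
    [k]. *)
Definition progressf (g : pform N) : pform N.+1 :=
  psub (shiftf m (prefixf m g)) (row_mx (traj m 0) 1%:M : 'M_(N, N.+1)) 0.

Definition wntf (g : pform N) : pform N :=
  PAnd (prefixf m g) (PAll (POr (PLe0 neg_lterm) (progressf g))).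

Lemma neg_ltermE z v : lterm_val neg_lterm (vcons z v) = z + 1.
Proof.
rewrite lterm_valE /=; congr (_ + _).
by rewrite -rowE mxE vcons0.
Qed.

Lemma sat_progressf g z v : qfree g ->
  sat (progressf g) (vcons z v) <->
  forall n, (n <= m)%N -> sat g (traj n (traj m (v + z *: traj m 0))).
Proof.
move=> qg; rewrite sat_psub ?qfree_shiftf ?qfree_prefixf //.
rewrite sat_shiftf ?qfree_prefixf // sat_prefixf //.
suff -> : row_mx (traj m 0) 1%:M *m vcons z v + 0 = v + z *: traj m 0 by [].
rewrite addr0 /vcons (mul_row_col (traj m 0)) mul1mx addrC; congr (_ + _).
have -> : const_mx z = z%:M :> 'cV_1 by apply/matrixP => i j; rewrite !mxE !ord1.
by rewrite mul_mx_scalar.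
Qed.

Lemma sat_wntf g v : qfree g -> (0 < m)%N ->
  sat (wntf g) v <-> forall n, sat g (traj n v).
Proof.
move=> qg m_gt0; rewrite (traj_periodic (sat g) v m_gt0) /= sat_prefixf //.
split=> -[h1 h2]; split=> //; [move=> k | move=> z].
  case: (h2 k%:Z) => [|h]; first by rewrite neg_ltermE; lia.
  by move: h; rewrite sat_progressf // -natz scaler_nat.
rewrite neg_ltermE sat_progressf //.
case: z => k; last by left; lia.
by right; rewrite -natz scaler_nat; exact: h2.
Qed.

End Orbit.

(** The relation is deterministic, so the orbit is the only candidate for an infinite run. *)
Lemma wntE N (R : affine N) :
  wnt R = [set v | forall n, sat (guard R) (traj (amat R) (avec R) n v)]%classic.
Proof.
apply/seteqP; split=> v /=.
  move=> [u [u0 hu]] n; suff <- : u n = traj (amat R) (avec R) n v by case: (hu n).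
  by elim: n => // n ih; case: (hu n) => -> _; rewrite ih.
move=> h; exists (fun n => traj (amat R) (avec R) n v).
by split=> // n; split=> //; exact: h.
Qed.

Lemma wntf_defines N (R : affine N) m : (0 < m)%N -> amat R ^+ (m + m) = amat R ^+ m ->
  defines (wntf (amat R) (avec R) m (guard R)) (wnt R).
Proof.
move=> m_gt0 idem; rewrite /defines wntE; apply/funext => v; apply/propext.
exact: (iff_sym (sat_wntf (avec R) idem v (guard_qfree R) m_gt0)).
Qed.

(** The powers of an element of a finite monoid are eventually periodic, and some positive power is
    therefore idempotent. *)
Lemma finite_monoid_idem N (R : affine N) : finite_monoid R ->
  exists m, amat R ^+ (m.+1 + m.+1) = amat R ^+ m.+1.
Proof.
move=> fin.
have [i [j [lt_ij e]]] : exists i j, (i < j)%N /\ amat R ^+ i = amat R ^+ j.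
  have [s hs] := iffLR (finite_seqP _) fin.
  have in_s n : amat R ^+ n \in s.
    by have : [set` s]%classic (amat R ^+ n) by rewrite -hs; exists n.
  (* Pigeonhole: one more power than there are elements in [s]. *)
  pose t := [seq amat R ^+ n | n <- iota 0 (size s).+1].
  have /(uniqPn 0)[i [j [lt_ij lt_js e]]] : ~~ uniq t.
    apply/negP => ut; suff /(uniq_leq_size ut) : {subset t <= s}.
      by rewrite size_map size_iota ltnn.
    by move=> _ /mapP[n _ ->].
  rewrite size_map size_iota in lt_js; exists i, j; split=> //.
  have lt_is := ltn_trans lt_ij lt_js.
  by move: e; rewrite !(nth_map 0%N) ?size_iota // !nth_iota.
pose c := (j - i)%N; have c_gt0 : (0 < c)%N by rewrite subn_gt0.
have per n k : (i <= n)%N -> amat R ^+ (n + c * k) = amat R ^+ n.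
  move=> le_in; elim: k => [|k ih]; first by rewrite muln0 addn0.
  rewrite -[RHS]ih mulnS addnA.
  have -> : (n + c + c * k = j + (n - i + c * k))%N by rewrite /c; lia.
  have -> : (n + c * k = i + (n - i + c * k))%N by lia.
  by rewrite !exprD e.
(* The exponent [c (i + 1)] is a multiple of the period [c] and is at least the preperiod [i]. *)
exists (c * i.+1).-1; rewrite prednK ?muln_gt0 ?c_gt0 // per //.
by rewrite mulnS; have := leq_pmull i c_gt0; lia.
Qed.

(** * Small models *)

Lemma dvdzNr (d m : int) : (d %| (- m)%R)%Z = (d %| m)%Z.
Proof. by rewrite !dvdzE abszN. Qed.

Definition small n (M : nat) (t : lterm n) : Prop :=
  (forall i, (`|(coef t 0 i)%R| <= M)%N) /\ (`|cst t| <= M)%N.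

(** The invariant of the back-and-forth argument. Testing [t <= 0] determines the full sign, because
    [-t] is small whenever [t] is. *)
Definition eqv n (M : nat) (a a' : 'cV[int]_n) : Prop :=
  (forall t, small M t -> (lterm_val t a <= 0) = (lterm_val t a' <= 0)) /\
  (forall i, (M`!%:Z %| (a i 0 - a' i 0)%R)%Z).

Lemma eqv_refl n M (a : 'cV[int]_n) : eqv M a a.
Proof. by split=> // i; rewrite subrr dvdz0. Qed.

Lemma eqv_sym n M (a a' : 'cV[int]_n) : eqv M a a' -> eqv M a' a.
Proof.
move=> [h1 h2]; split=> [t /h1 -> //|i].
by rewrite -opprB dvdzNr.
Qed.

Lemma eqv_opp n M (a a' : 'cV[int]_n) : eqv M a a' -> eqv M (- a) (- a').
Proof.
move=> [h1 h2]; split=> [t [s1 s2]|i]; last by rewrite !mxE -opprD dvdzNr.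
have e v : lterm_val t (- v) = lterm_val (LTerm (- coef t) (cst t)) v.
  by rewrite !lterm_valE mulmxN mulNmx.
by rewrite !e h1 //; split=> //= i; rewrite mxE abszN.
Qed.

Definition lcomb n (p q r : int) (t u : lterm n) : lterm n :=
  LTerm (p *: coef t + q *: coef u) (p * cst t + q * cst u + r).

Lemma lcombE n p q r (t u : lterm n) v :
  lterm_val (lcomb p q r t u) v = p * lterm_val t v + q * lterm_val u v + r.
Proof.
rewrite !lterm_valE /= mulmxDl -!scalemxAl.
by move: (coef t *m v) (coef u *m v) => X Y; rewrite !mxE; ring.
Qed.

Lemma small_lcomb n (p q r : int) (t u : lterm n) M M' :
  small M t -> small M u -> (`|p| * M + `|q| * M + `|r| <= M')%N ->
  small M' (lcomb p q r t u).
Proof.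
move=> [t1 t2] [u1 u2] le_M'; split=> [i|] /=.
  rewrite !mxE.
  have := leq_mul (leqnn `|p|%N) (t1 i); have := leq_mul (leqnn `|q|%N) (u1 i).
  rewrite -!abszM; move: (p * _) (q * _) le_M' => x y.
  by move: (_ * M)%N (_ * M)%N => pM qM; lia.
have := leq_mul (leqnn `|p|%N) t2; have := leq_mul (leqnn `|q|%N) u2.
rewrite -!abszM; move: (p * _) (q * _) le_M' => x y.
by move: (_ * M)%N (_ * M)%N => pM qM; lia.
Qed.

Lemma small_widen n M M' (t : lterm n) : (M <= M')%N -> small M t -> small M' t.
Proof. by move=> le_M [h1 h2]; split=> [i|]; apply: leq_trans le_M. Qed.

Lemma small_val n M B (t : lterm n) (v : 'cV[int]_n) :
  small M t -> (forall i, (`|(v i 0)%R| <= B)%N) -> (`|lterm_val t v| <= M * (n * B).+1)%N.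
Proof.
move=> [h1 h2] hv.
have h : `|\sum_(i < n) coef t 0 i * v i 0| <= (M * (n * B))%N%:Z.
  apply: le_trans (ler_norm_sum _ _ _) _.
  have -> : (M * (n * B))%N%:Z = \sum_(i < n) (M * B)%N%:Z.
    by rewrite sumr_const card_ord -mulr_natr natz -PoszM mulnCA mulnC.
  by apply: ler_sum => i _; rewrite -abszE lez_nat abszM leq_mul.
by rewrite /lterm_val; move: h; rewrite -abszE; lia.
Qed.

(** Put [W = M!]. Forms scaled by a divisor of [W] have height at most [W M]; a difference of two of
    them, shifted by at most [W^2], has height at most [nxt M]. Moreover [W^2] divides
    [(nxt M)!]. *)
Definition nxt (M : nat) : nat := (2 * (M`! * M) + M`! * M`!)%N.

(** The first summand bounds a form of height [M! M] on the box of radius [B], the second the offset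
    added to it. *)
Definition beta (n M B : nat) : nat := (M`! * M * (n * B).+1 + M`! * M`!)%N.

Lemma leq_nxt M : (M <= nxt M)%N.
Proof.
have := leq_pmull M (fact_gt0 M); rewrite /nxt; lia.
Qed.

Lemma dvd_nxt M : ((M`! * M`!)%N %| (nxt M)`!)%N.
Proof. by rewrite dvdn_fact // muln_gt0 !fact_gt0 /= leq_addl. Qed.

Lemma dvdz_lterm n (d : int) (t : lterm n) (a a' : 'cV[int]_n) :
  (forall i, (d %| (a i 0 - a' i 0)%R)%Z) -> (d %| lterm_val t a - lterm_val t a')%Z.
Proof.
move=> h; rewrite /lterm_val opprD addrACA subrr addr0 -sumrB.
apply: rpred_sum => i _; rewrite -mulrBr; exact: dvdz_mull.
Qed.

(** The new coordinate is scaled by [W] so that a coefficient dividing [W] can be cleared and an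
    atom becomes a comparison of [W x] with a form in the old coordinates. *)
Definition same_pos n (K W : nat) (x : int) (a : 'cV[int]_n) x' a' : Prop :=
  forall t, small K t ->
    (lterm_val t a <= W%:Z * x) = (lterm_val t a' <= W%:Z * x') /\
    (W%:Z * x <= lterm_val t a) = (W%:Z * x' <= lterm_val t a').

(** A positive [e] gets its representative in [[1, U]] rather than [[0, U - 1]], so that being zero
    is reflected. *)
Lemma reduce_modn U e : (0 < U)%N ->
  exists e' d, [/\ e = (e' + U * d)%N, (e' <= U)%N & e' = 0%N -> e = 0%N].
Proof.
move=> U_gt0; case: e => [|e]; first by exists 0%N, 0%N; rewrite muln0.
exists (e %% U).+1, (e %/ U)%N; split=> //; last by rewrite ltn_mod.
by have := divn_eq e U; lia.
Qed.

(** Take the form [t1] whose value at [a] is closest to [W x] from below, with gap [e], and place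
    [W x'] above [t1(a')] at a gap [e'] congruent to [e] modulo [W^2] and at most [W^2]. *)
Lemma same_pos_ge0 n M B x (a a' : 'cV[int]_n) :
  0 <= x -> eqv (nxt M) a a' -> (forall i, (`|(a' i 0)%R| <= B)%N) ->
  exists x', [/\ same_pos (M`! * M) M`! x a x' a', (M`!%:Z %| x - x')%Z
               & (`|x'| <= beta n M B)%N].
Proof.
move=> x_ge0 [aa' dvd_aa'] le_a'B.
set W := M`!; set K := (W * M)%N; set U := (W * W)%N.
have W_gt0 : (0 < W)%N by exact: fact_gt0.
have U_gt0 : (0 < U)%N by rewrite muln_gt0 W_gt0.
(* The possible gaps below [W x]; as [x >= 0], the zero form provides one, so a least gap exists. *)
pose P e := exists2 t, small K t & W%:Z * x - lterm_val t a = e%:Z.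
have exP : exists e, `[< P e >].
  exists `|(W%:Z * x)%R|%N; apply/asboolP; exists (LTerm 0 0).
    by split=> // i; rewrite mxE.
  rewrite lterm_valE mul0mx mxE !subr0 abszE ger0_norm //.
  by rewrite mulr_ge0.
case: (ex_minnP exP) => e /asboolP[t1 small1 e_def] e_min.
have [e' [d [eE le_e'U e'0]]] := reduce_modn e U_gt0.
have /dvdzP[j jE] : (U%:Z %| lterm_val t1 a' - lterm_val t1 a)%Z.
  apply: dvdz_lterm => i; rewrite -opprB dvdzNr.
  by apply: dvdz_trans (dvd_aa' i); exact: dvd_nxt.
(* The solution of [W x' = t1(a') + e'], integral because [t1(a') - t1(a) = j W^2] and
   [e - e' = d W^2]. *)
exists (x + W%:Z * (j - d%:Z)).
have x'E : W%:Z * (x + W%:Z * (j - d%:Z)) = lterm_val t1 a' + e'%:Z.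
  have -> : lterm_val t1 a' = lterm_val t1 a + j * U%:Z by rewrite -jE; ring.
  have -> : lterm_val t1 a = W%:Z * x - e%:Z by rewrite -e_def; ring.
  by rewrite eE /U PoszD !PoszM; ring.
have xE : W%:Z * x = lterm_val t1 a + e%:Z by rewrite -e_def; ring.
split.
- move=> t small_t; rewrite x'E xE.
  have cmp p q (r : int) : `|p|%N = 1%N -> `|q|%N = 1%N -> (`|r| <= U)%N ->
      (p * lterm_val t a + q * lterm_val t1 a + r <= 0) =
      (p * lterm_val t a' + q * lterm_val t1 a' + r <= 0).
    move=> p1 q1 le_rU; rewrite -!lcombE; apply: aa'; apply: (small_lcomb small_t small1).
    by rewrite p1 q1 /nxt -/W -/K -/U; lia.
  have c1 := cmp 1 (-1) 0 erefl erefl isT.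
  have c2 := cmp (-1) 1 e'%:Z erefl erefl le_e'U.
  have c3 := cmp 1 (-1) (- e'%:Z) erefl erefl; rewrite abszN in c3.
  have {}c3 := c3 le_e'U.
  (* By minimality of [e], no form of height [K] takes at [a] a value above [t1(a)] and at most
     [W x]. *)
  have min_t : lterm_val t a <= lterm_val t1 a + e%:Z -> lterm_val t a <= lterm_val t1 a.
    rewrite -xE -subr_ge0 => nn.
    have /e_min : `[< P `|(W%:Z * x - lterm_val t a)%R|%N >].
      by apply/asboolP; exists t => //; rewrite abszE ger0_norm.
    by have := gez0_abs nn; rewrite xE; lia.
  move: c1 c2 c3 min_t e'0 eE; clear; nia.
- by rewrite opprD addrA subrr sub0r dvdzNr dvdz_mulr.
- set x' := x + _.
  have := small_val small1 le_a'B.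
  have : (`|x'| <= `|(W%:Z * x')%R|)%N by rewrite abszM leq_pmull.
  rewrite x'E /beta -/W -/K -/U; lia.
Qed.

(** The case [x < 0] follows by reflection: negating all coordinates exchanges the two
    comparisons. *)
Lemma same_pos_ex n M B x (a a' : 'cV[int]_n) :
  eqv (nxt M) a a' -> (forall i, (`|(a' i 0)%R| <= B)%N) ->
  exists x', [/\ same_pos (M`! * M) M`! x a x' a', (M`!%:Z %| x - x')%Z
               & (`|x'| <= beta n M B)%N].
Proof.
move=> aa' le_a'B; case: (lerP 0 x) => [x_ge0|/ltW x_le0].
  exact: same_pos_ge0 x_ge0 aa' le_a'B.
have nx_ge0 : 0 <= - x by rewrite oppr_ge0.
have [i|x' [pos dvd bnd]] := same_pos_ge0 nx_ge0 (eqv_opp aa') (B := B).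
  by rewrite mxE abszN.
exists (- x'); split; last by rewrite abszN.
  move=> t [s1 s2]; have [|] := pos (LTerm (coef t) (- cst t)).
    by split=> //=; rewrite abszN.
  have e v : lterm_val (LTerm (coef t) (- cst t)) (- v) = - lterm_val t v.
    by rewrite !lterm_valE /= mulmxN mxE opprD.
  by rewrite !e !mulrN !lerN2 lerNr lerNl => h1 h2; rewrite h1 h2 lerNr lerNl.
by rewrite opprK -dvdzNr opprD.
Qed.

Definition ltail n (t : lterm n.+1) : lterm n :=
  LTerm (\row_i coef t 0 (lift 0 i)) (cst t).

Lemma lterm_vcons n (t : lterm n.+1) x v :
  lterm_val t (vcons x v) = coef t 0 0 * x + lterm_val (ltail t) v.
Proof.
rewrite /lterm_val big_ord_recl vcons0 addrA; congr (_ + _ + _).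
by apply: eq_bigr => i _; rewrite vconsS mxE.
Qed.

(** One round of the game. If the coefficient [c] of [x] is nonzero, it divides [M!]; multiplying
    [c x + l <= 0] by [q = M! / |c|] compares [M! x] with [-q l] or [q l], according to the sign of
    [c]. If [c = 0], only old coordinates occur. *)
Lemma eqv_extend n M B x (a a' : 'cV[int]_n) :
  eqv (nxt M) a a' -> (forall i, (`|(a' i 0)%R| <= B)%N) ->
  exists2 x', eqv M (vcons x a) (vcons x' a') & (`|x'| <= beta n M B)%N.
Proof.
move=> aa' le_a'B; have [x' [pos dvd bnd]] := same_pos_ex x aa' le_a'B.
exists x' => //; split=> [t small_t|i]; last first.
  case: (unliftP 0 i) => [j|] ->; last by rewrite !vcons0.
  rewrite !vconsS; case: aa' => _ /(_ j); apply: dvdz_trans.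
  by apply: dvdn_trans (dvd_nxt M); exact: dvdn_mulr.
have small_tl : small M (ltail t).
  by case: small_t => s1 s2; split=> //= i; rewrite mxE.
rewrite !lterm_vcons; set l := lterm_val _ a; set l' := lterm_val _ a'.
have scaled (c q : nat) (s : int) : (0 < c)%N -> M`! = (q * c)%N -> `|s|%N = q ->
    small (M`! * M) (lcomb s 0 0 (ltail t) (ltail t)).
  move=> c_gt0 qE sE; apply: (small_lcomb small_tl small_tl).
  by rewrite sE qE !addn0 leq_mul2r leq_pmulr ?orbT.
have fac c : (0 < c)%N -> (c <= M)%N -> exists2 q, M`! = (q * c)%N & (0 < q)%N.
  move=> c_gt0 le_cM; have /dvdnP[q qE] : (c %| M`!)%N by rewrite dvdn_fact ?c_gt0.
  by exists q => //; have := fact_gt0 M; rewrite qE muln_gt0 => /andP[].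
have le_cM : (`|(coef t 0 0)%R| <= M)%N by case: small_t.
case: (ltrgt0P (coef t 0 0)) => [c_gt0|c_lt0|->].
- have [||q qE q_gt0] := fac `|(coef t 0 0)%R|%N; rewrite ?absz_gt0 ?gt_eqF //.
  have [|_] := pos (lcomb (- q%:Z) 0 0 (ltail t) (ltail t)).
    by apply: scaled qE _; rewrite ?abszN ?absz_gt0 ?gt_eqF.
  rewrite !lcombE -/l -/l' qE PoszM gtz0_abs // !mul0r !addr0 !mulNr.
  by move: (coef t 0 0) c_gt0 => c c_gt0; clear -q_gt0 => h; nia.
- have [||q qE q_gt0] := fac `|(coef t 0 0)%R|%N; rewrite ?absz_gt0 ?lt_eqF //.
  have [|h _] := pos (lcomb q%:Z 0 0 (ltail t) (ltail t)).
    by apply: scaled qE _; rewrite ?absz_gt0 ?lt_eqF.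
  move: h; rewrite !lcombE -/l -/l' qE PoszM ltz0_abs // !mul0r !addr0.
  by move: (coef t 0 0) c_lt0 => c c_lt0; clear -q_gt0 => h; nia.
- rewrite !mul0r !add0r; case: aa' => h _; apply: h.
  exact: small_widen (leq_nxt M) small_tl.
Qed.

(* [mu j] is the precision kept when [j] coordinates have been chosen. *)
Definition box (mu : nat -> nat) (n : nat) : nat :=
  iteri n (fun j B => B + beta j (mu j.+1) B)%N 0%N.

Lemma vcons_split n (v : 'cV[int]_n.+1) : v = vcons (v 0 0) (\col_i v (lift 0 i) 0).
Proof.
apply/colP => i; case: (unliftP 0 i) => [j|] ->; last by rewrite vcons0.
by rewrite vconsS mxE.
Qed.

(** The tail is replaced first, at a finer precision, and coordinate [0] is then matched by one
    round of the game. *)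
Lemma eqv_box (mu : nat -> nat) n (v : 'cV[int]_n) :
  (forall j, (j < n)%N -> mu j = nxt (mu j.+1)) ->
  exists2 v', eqv (mu n) v v' & forall i, (`|(v' i 0)%R| <= box mu n)%N.
Proof.
elim: n v => [|n ih] v mu_nxt.
  by exists v => [|[]//]; exact: eqv_refl.
have [j lt_jn|w' ew bw] := ih (\col_i v (lift 0 i) 0).
  by apply: mu_nxt; exact: ltnW.
rewrite mu_nxt // in ew.
have [x' ex bx] := eqv_extend (v 0 0) ew bw.
exists (vcons x' w'); first by rewrite [v]vcons_split.
move=> i; rewrite /box iteriS -/(box mu n).
case: (unliftP 0 i) => [j|] ->; rewrite ?vcons0 ?vconsS.
  exact: leq_trans (bw j) (leq_addr _ _).
exact: leq_trans bx (leq_addl _ _).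
Qed.

(** * Computations on codes *)

Definition ent (e i j : nat) : int := dint (kid (kid e i) j).

Lemma ent_code_mx m n (M : 'M[int]_(m, n)) (i : 'I_m) (j : 'I_n) :
  ent (code_mx M) i j = M i j.
Proof.
rewrite /ent kid_code (nth_map i) ?size_enum_ord // nth_ord_enum kid_code.
by rewrite (nth_map j) ?size_enum_ord // nth_ord_enum code_intK.
Qed.

Lemma leq_ent e i j : (`|ent e i j| <= e)%N.
Proof.
apply: leq_trans (leq_dint _) _.
have h t k : (kid t k <= t)%N := leq_trans (leq_kid t k) (leq_pred t).
exact: leq_trans (h _ _) (h _ _).
Qed.

(** Dimensions are plain arguments and entries are indexed by naturals, so matrix operations become
    non-dependent functions on codes. *)
Definition cmk (m n : nat) (F : nat -> nat -> int) : nat :=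
  code_seq (mkseq (fun i => code_seq (mkseq (fun j => code_int (F i j)) n)) m).

Lemma mkseq_ord T (f : nat -> T) n : mkseq f n = [seq f i | i : 'I_n <- enum 'I_n].
Proof. by rewrite /mkseq -val_enum_ord -map_comp. Qed.

Lemma cmkE m n (F : nat -> nat -> int) (M : 'M[int]_(m, n)) :
  (forall (i : 'I_m) (j : 'I_n), F i j = M i j) -> cmk m n F = code_mx M.
Proof.
move=> h; rewrite /cmk mkseq_ord; congr code_seq; apply: eq_map => i.
by rewrite mkseq_ord; congr code_seq; apply: eq_map => j; rewrite h.
Qed.

Lemma ent_cmk m n F i j : (i < m)%N -> (j < n)%N -> ent (cmk m n F) i j = F i j.
Proof.
move=> lt_im lt_jn; rewrite /ent !kid_code !nth_mkseq // kid_code nth_mkseq //.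
exact: code_intK.
Qed.

Definition cmul (m n k e e' : nat) : nat :=
  cmk m k (fun i j => \sum_(0 <= l < n) ent e i l * ent e' l j).

Lemma cmulE m n k (M : 'M[int]_(m, n)) (M' : 'M_(n, k)) :
  cmul m n k (code_mx M) (code_mx M') = code_mx (M *m M').
Proof.
apply: cmkE => i j; rewrite big_mkord mxE; apply: eq_bigr => l _.
by rewrite !ent_code_mx.
Qed.

Definition cadd (m n e e' : nat) : nat := cmk m n (fun i j => ent e i j + ent e' i j).

Lemma caddE m n (M M' : 'M[int]_(m, n)) :
  cadd m n (code_mx M) (code_mx M') = code_mx (M + M').
Proof. by apply: cmkE => i j; rewrite !ent_code_mx mxE. Qed.

Definition cdot (n e e' : nat) : int := \sum_(0 <= l < n) ent e 0 l * ent e' l 0.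

(** Every number is read as some vector, so a search over vectors can be a search over numbers. *)
Definition cvec (n e : nat) : 'cV[int]_n := \col_i ent e i 0.

Lemma cvec_code n (v : 'cV[int]_n) : cvec n (code_mx v) = v.
Proof. by apply/colP => i; rewrite mxE (ent_code_mx v i 0). Qed.

Lemma cdotE n (t : lterm n) e :
  cdot n (code_mx (coef t)) e + cst t = lterm_val t (cvec n e).
Proof.
congr (_ + _); rewrite /cdot big_mkord; apply: eq_bigr => i _.
by rewrite (ent_code_mx _ 0) mxE.
Qed.

Lemma comp_ent X {eX : Enc X} (e i j : X -> nat) :
  computable e -> computable i -> computable j ->
  computable (fun x => ent (e x) (i x) (j x)).
Proof. by move=> ce ci cj; apply: comp_dint; do 2?apply: comp_kid. Qed.

Lemma comp_cmk X {eX : Enc X} (m n : X -> nat) (F : X -> nat -> nat -> int) :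
  computable m -> computable n ->
  computable (fun z : X * nat * nat => F z.1.1 z.1.2 z.2) ->
  computable (fun x => cmk (m x) (n x) (F x)).
Proof.
move=> cm cn cF; apply: comp_code_seq; apply: comp_mkseq => //.
apply: comp_code_seq; apply: (comp_mkseq (F := fun z j => code_int (F z.1 z.2 j))).
  by comp_solve.
exact: comp_code_int.
Qed.

Ltac comp_step_data := match goal with
  | |- computable (fun x => (@?f x + @?g x)%R) => apply (comp_addz (f := f) (g := g))
  | |- computable (fun x => (@?f x * @?g x)%R) => apply (comp_mulz (f := f) (g := g))
  | |- computable (fun x => (@?f x <= 0)%R) => apply (comp_le0z (f := f))
  | |- computable (fun x => Posz (@?f x)) => apply (comp_Posz (f := f))
  | |- computable (fun x => nat_of_bool (@?f x)) => apply (comp_bool_nat (b := f))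
  | |- computable (fun x => dint (@?f x)) => apply (comp_dint (f := f))
  | |- computable (fun x => code_int (@?f x)) => apply (comp_code_int (f := f))
  | |- computable (fun x => code_seq (@?f x)) => apply (comp_code_seq (f := f))
  | |- computable (fun x => @?f x :: @?g x) => apply (comp_cons (a := f) (s := g))
  | |- computable (fun x => kid (@?f x) (@?g x)) => apply (comp_kid (t := f) (i := g))
  | |- computable (fun x => ent (@?f x) (@?g x) (@?h x)) =>
      apply (comp_ent (e := f) (i := g) (j := h))
  | |- computable (fun x => cmk (@?f x) (@?g x) (@?h x)) =>
      apply (comp_cmk (m := f) (n := g) (F := h))
  | |- computable (fun x => (\sum_(0 <= i < @?n x) (@?F x i))%R) =>
      apply (comp_sum (n := n) (F := F))
  end.

Ltac comp_solve ::= repeat ((comp_step || comp_step_data); cbv beta).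

Lemma comp_cmul X {eX : Enc X} (m n k e e' : X -> nat) : computable m -> computable n ->
  computable k -> computable e -> computable e' ->
  computable (fun x => cmul (m x) (n x) (k x) (e x) (e' x)).
Proof.
move=> cm cn ck ce ce'; rewrite /cmul; comp_solve.
Qed.

Lemma comp_cadd X {eX : Enc X} (m n e e' : X -> nat) : computable m -> computable n ->
  computable e -> computable e' ->
  computable (fun x => cadd (m x) (n x) (e x) (e' x)).
Proof. by move=> cm cn ce ce'; rewrite /cadd; comp_solve. Qed.

Lemma comp_cdot X {eX : Enc X} (n e e' : X -> nat) :
  computable n -> computable e -> computable e' ->
  computable (fun x => cdot (n x) (e x) (e' x)).
Proof. by move=> cn ce ce'; rewrite /cdot; comp_solve. Qed.

Ltac comp_step_matrix := match goal with
  | |- computable (fun x => cmul (@?m x) (@?n x) (@?k x) (@?e x) (@?e' x)) =>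
      apply (comp_cmul (m := m) (n := n) (k := k) (e := e) (e' := e'))
  | |- computable (fun x => cadd (@?m x) (@?n x) (@?e x) (@?e' x)) =>
      apply (comp_cadd (m := m) (n := n) (e := e) (e' := e'))
  | |- computable (fun x => cdot (@?n x) (@?e x) (@?e' x)) =>
      apply (comp_cdot (n := n) (e := e) (e' := e'))
  end.

Ltac comp_solve ::= repeat ((comp_step || comp_step_data || comp_step_matrix); cbv beta).

(** The dimensions and the substitution are parameters of a recursion on the code: atoms are
    recomputed by matrix operations, connectives keep their tag. *)
Lemma csub_ex : exists V : nat * nat * nat * nat -> nat -> nat,
  computable (fun z => V z.1 z.2) /\
  forall n (f : pform n) k (M : 'M_(n, k)) s, qfree f ->
    V (k, n, code_mx M, code_mx s) (code_pform f) = code_pform (psub f M s).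
Proof.
pose h (x : nat * nat * nat * nat) t v1 v2 : nat :=
  if kid t 0 == 0%N then
    code_seq [:: 0; cmul 1 x.1.1.2 x.1.1.1 (kid t 1) x.1.2;
                 code_int (cdot x.1.1.2 (kid t 1) x.2 + dint (kid t 2))]%N
  else if kid t 0 == 1%N then code_seq [:: 1; v1]%N
  else code_seq [:: kid t 0; v1; v2].
have [|V [cV VE]] := @comp_tree_rec _ _ h; first by rewrite /h; comp_solve.
exists V; split=> // n; elim=> {}n.
- move=> t k M s _; rewrite VE // /h /code_pform !kid_code [nth _ _ _]/= [nth _ _ 1]/=.
  rewrite [nth _ _ 2]/= eqxx cmulE code_intK.
  suff -> : cdot n (code_mx (coef t)) (code_mx s) = (coef t *m s) 0 0 by [].
  rewrite /cdot big_mkord mxE; apply: eq_bigr => l _.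
  by rewrite (ent_code_mx _ 0) (ent_code_mx _ _ 0).
- move=> f ih k M s qf; rewrite VE // /h -[code_pform (PNot f)]/(code_seq [:: 1; code_pform f]%N)
       !kid_code.
  by rewrite /= ih.
- move=> f ihf g ihg k M s /andP[qf qg].
  by rewrite VE // /h -[code_pform (PAnd f g)]/(code_seq [:: 2; code_pform f; code_pform g]%N)
       !kid_code /= ihf // ihg.
- move=> f ihf g ihg k M s /andP[qf qg].
  by rewrite VE // /h -[code_pform (POr f g)]/(code_seq [:: 3; code_pform f; code_pform g]%N)
       !kid_code /= ihf // ihg.
- by [].
- by [].
Qed.

Definition csub := sval (cid csub_ex).

Lemma comp_csub : computable (fun z => csub z.1 z.2).
Proof. by rewrite /csub; case: cid => V []. Qed.

Lemma csubE n (f : pform n) k (M : 'M_(n, k)) s : qfree f ->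
  csub (k, n, code_mx M, code_mx s) (code_pform f) = code_pform (psub f M s).
Proof. by rewrite /csub; case: cid => V [? VE]; exact: VE. Qed.

(** Truth at a given point is decided by recursion on the code, with truth values [0] and [1]. *)
Lemma ceval_ex : exists V : nat * nat -> nat -> nat,
  computable (fun z => V z.1 z.2) /\
  forall n (f : pform n) e, qfree f ->
    V (n, e) (code_pform f) = `[< sat f (cvec n e) >].
Proof.
pose h (x : nat * nat) t v1 v2 : nat :=
  if kid t 0 == 0%N then nat_of_bool (cdot x.1 (kid t 1) x.2 + dint (kid t 2) <= 0)%R
  else if kid t 0 == 1%N then nat_of_bool (v1 == 0%N)
  else if kid t 0 == 2%N then nat_of_bool (~~ (v1 == 0%N) && ~~ (v2 == 0%N))
  else nat_of_bool (~~ (v1 == 0%N) || ~~ (v2 == 0%N)).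
have [|V [cV VE]] := @comp_tree_rec _ _ h; first by rewrite /h; comp_solve.
have b0 (b : bool) : (b == 0%N :> nat) = ~~ b by case: b.
exists V; split=> // n; elim=> {}n.
- move=> t e _; rewrite VE // /h /code_pform !kid_code [nth _ _ _]/= [nth _ _ 1]/=.
  by rewrite [nth _ _ 2]/= eqxx code_intK cdotE /= asboolb.
- move=> f ih e qf; rewrite VE // /h -[code_pform (PNot f)]/(code_seq [:: 1; code_pform f]%N)
       !kid_code.
  by rewrite /= ih // b0 /= asbool_neg.
- move=> f ihf g ihg e /andP[qf qg].
  by rewrite VE // /h -[code_pform (PAnd f g)]/(code_seq [:: 2; code_pform f; code_pform g]%N)
       !kid_code /= ihf // ihg // !b0 !negbK asbool_and.
- move=> f ihf g ihg e /andP[qf qg].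
  by rewrite VE // /h -[code_pform (POr f g)]/(code_seq [:: 3; code_pform f; code_pform g]%N)
       !kid_code /= ihf // ihg // !b0 !negbK asbool_or.
- by [].
- by [].
Qed.

Definition ceval := sval (cid ceval_ex).

Lemma comp_ceval : computable (fun z => ceval z.1 z.2).
Proof. by rewrite /ceval; case: cid => V []. Qed.

Lemma cevalE n (f : pform n) e : qfree f ->
  ceval (n, e) (code_pform f) = `[< sat f (cvec n e) >].
Proof. by rewrite /ceval; case: cid => V [? VE]; exact: VE. Qed.

Lemma leq_code_mx m n (M : 'M[int]_(m, n)) i j : (`|(M i j)%R| <= code_mx M)%N.
Proof. by rewrite -ent_code_mx leq_ent. Qed.

Lemma leq_code_seq s i : (nth 0 s i <= code_seq s)%N.
Proof. exact: leq_trans (leq_nth_code s i) (leq_pred _). Qed.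

(** A code dominates the coefficients inside it, so the code of a formula can itself serve as
    precision. *)
Lemma small_code n (t : lterm n) M : (code_pform (PLe0 t) <= M)%N -> small M t.
Proof.
move=> le_M; split=> [i|]; apply: leq_trans le_M; rewrite /code_pform.
  apply: leq_trans (leq_code_mx (coef t) 0 i) _; exact: (leq_code_seq _ 1).
rewrite -[cst t]code_intK; apply: leq_trans (leq_dint _) _; rewrite code_intK.
exact: (leq_code_seq [:: _; _; _] 2).
Qed.

Lemma eqv_sat n (f : pform n) M a a' : qfree f -> (code_pform f <= M)%N ->
  eqv M a a' -> sat f a <-> sat f a'.
Proof.
elim: f a a' => {}n //.
- by move=> t a a' _ le_M [/(_ t (small_code le_M)) /= -> _].
- move=> f ih a a' qf le_M aa' /=.
  by rewrite (ih a a') //; apply: leq_trans le_M; exact: (leq_code_seq [:: _; _] 1).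
- move=> f ihf g ihg a a' /andP[qf qg] le_M aa' /=.
  rewrite (ihf a a') // ?(ihg a a') //; apply: leq_trans le_M.
    exact: (leq_code_seq [:: _; _; _] 2).
  exact: (leq_code_seq [:: _; _; _] 1).
- move=> f ihf g ihg a a' /andP[qf qg] le_M aa' /=.
  rewrite (ihf a a') // ?(ihg a a') //; apply: leq_trans le_M.
    exact: (leq_code_seq [:: _; _; _] 2).
  exact: (leq_code_seq [:: _; _; _] 1).
Qed.

(** * Small models for a quantifier free formula with one universal quantifier *)

Section SmallModel.
Variables (N : nat) (H : pform N) (K : pform N.+1) (M : nat).
Hypotheses (qH : qfree H) (qK : qfree K).
Hypotheses (le_HM : (code_pform H <= M)%N) (le_KM : (code_pform K <= M)%N).
Hypothesis M_gt0 : (0 < M)%N.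

Definition univ_sat (v : 'cV[int]_N) : Prop :=
  sat H v /\ forall k : nat, sat K (vcons k%:Z v).

(** The form [z + 1] has height [1 <= M], so the game answers a natural number by a natural
    number. *)
Lemma eqv_vcons_ge0 x x' (a a' : 'cV[int]_N) :
  eqv M (vcons x a) (vcons x' a') -> 0 <= x -> 0 <= x'.
Proof.
move=> [h _]; have := h (neg_lterm N); rewrite !neg_ltermE => e.
have {e}/e : small M (neg_lterm N).
  by split=> //= i; rewrite mxE; case: (_ && _).
lia.
Qed.

Lemma univ_sat_bounded (v : 'cV[int]_N) B : (forall i, (`|(v i 0)%R| <= B)%N) ->
  univ_sat v <->
  sat H v /\ forall k : nat, (k <= beta N M B)%N -> sat K (vcons k%:Z v).
Proof.
move=> le_vB; split=> -[Hv Kv]; split=> // k.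
(* The game is played with [v] on both sides: any [k] is answered by one in the bounded range. *)
have [x' ex bx] := eqv_extend k%:Z (eqv_refl (nxt M) v) le_vB.
have x'_ge0 := eqv_vcons_ge0 ex isT.
apply/(eqv_sat qK le_KM ex); rewrite -(gez0_abs x'_ge0); exact: Kv.
Qed.

Lemma univ_sat_eqv v v' : eqv (nxt M) v v' -> univ_sat v -> univ_sat v'.
Proof.
move=> vv' [Hv Kv]; split=> [|k].
  by apply/(eqv_sat qH _ vv') => //; exact: leq_trans le_HM (leq_nxt M).
(* The value [k] is chosen on the side of [v'] and answered on that of [v], whose entries are
   bounded by this sum. *)
have [|x ex _] := eqv_extend (B := \sum_i `|(v i 0)%R|%N) k%:Z (eqv_sym vv').
  by move=> i; rewrite (bigD1 i) //= leq_addr.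
have x_ge0 := eqv_vcons_ge0 ex isT.
apply/(eqv_sat qK le_KM ex); rewrite -(gez0_abs x_ge0); exact: Kv.
Qed.

(** After all [n] coordinates, precision [nxt M] is left: one more round, for the universal [k]. *)
Definition precision (n j : nat) : nat := iter (n - j) nxt (nxt M).

Lemma univ_sat_small v : univ_sat v ->
  exists2 v', univ_sat v' & forall i, (`|(v' i 0)%R| <= box (precision N) N)%N.
Proof.
move=> sv; have [|v' vv' bv'] := @eqv_box (precision N) N v.
  by move=> j lt_jN; rewrite /precision -iterS -subSn.
exists v' => //; apply: univ_sat_eqv sv.
by move: vv'; rewrite /precision subnn.
Qed.

End SmallModel.

(** * Bounded search and computability of the bounds *)

Definition bex (n : nat) (P : pred nat) : bool := iteri n (fun i r => r || P i) false.

Lemma bexP n (P : pred nat) : reflect (exists2 i, (i < n)%N & P i) (bex n P).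
Proof.
elim: n => [|n ih]; first by constructor=> -[].
rewrite /bex iteriS; apply: (iffP orP) => [[/ih[i lt_in Pi]|Pn]|[i]].
- by exists i => //; exact: ltnW.
- by exists n.
- rewrite ltnS leq_eqVlt => /orP[/eqP->|lt_in] Pi; first by right.
  by left; apply/ih; exists i.
Qed.

Lemma comp_bex X {eX : Enc X} (n : X -> nat) (P : X -> nat -> bool) :
  computable n -> computable (fun z : X * nat => P z.1 z.2) ->
  computable (fun x => bex (n x) (P x)).
Proof. by move=> cn cP; rewrite /bex; comp_solve. Qed.

Lemma comp_fact X {eX : Enc X} (f : X -> nat) :
  computable f -> computable (fun x => (f x)`!).
Proof.
move=> cf.
have c : computable (fun x : X => iteri (f x) (fun i r => i.+1 * r)%N 1%N) by comp_solve.
by apply: comp_ext c => x; elim: (f x) => //= k ->; rewrite factS.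
Qed.

Lemma comp_nxt X {eX : Enc X} (f : X -> nat) :
  computable f -> computable (fun x => nxt (f x)).
Proof. by move=> cf; rewrite /nxt; comp_solve; apply: comp_fact. Qed.

Lemma comp_beta X {eX : Enc X} (n M B : X -> nat) :
  computable n -> computable M -> computable B ->
  computable (fun x => beta (n x) (M x) (B x)).
Proof. by move=> cn cM cB; rewrite /beta; comp_solve; apply: comp_fact. Qed.

Lemma comp_csub2 X {eX : Enc X} (x : X -> nat * nat * nat * nat) (f : X -> nat) :
  computable x -> computable f -> computable (fun z => csub (x z) (f z)).
Proof. exact: comp_ctx2 comp_csub. Qed.

Lemma comp_ceval2 X {eX : Enc X} (x : X -> nat * nat) (f : X -> nat) :
  computable x -> computable f -> computable (fun z => ceval (x z) (f z)).
Proof. exact: comp_ctx2 comp_ceval. Qed.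

Ltac comp_step_formula := match goal with
  | |- computable (fun x => nxt (@?f x)) => apply (comp_nxt (f := f))
  | |- computable (fun x => beta (@?n x) (@?M x) (@?B x)) =>
      apply (comp_beta (n := n) (M := M) (B := B))
  | |- computable (fun x => bex (@?n x) (@?P x)) => apply (comp_bex (n := n) (P := P))
  | |- computable (fun x => csub (@?u x) (@?f x)) => apply (comp_csub2 (x := u) (f := f))
  | |- computable (fun x => ceval (@?u x) (@?f x)) => apply (comp_ceval2 (x := u) (f := f))
  end.

Ltac comp_solve ::=
  repeat ((comp_step || comp_step_data || comp_step_matrix || comp_step_formula); cbv beta).

Lemma comp_box X {eX : Enc X} (M N : X -> nat) : computable M -> computable N ->
  computable (fun x => box (precision (M x) (N x)) (N x)).
Proof. by move=> cM cN; rewrite /box /precision; comp_solve. Qed.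

(** * The formula and the emptiness test as functions of the code of the relation *)

Definition cprefix (c m : nat) : nat :=
  iter m (fun f => code_seq [:: 2; kid c 3; csub (kid c 0, kid c 0, kid c 1, kid c 2) f]%N)
    (kid c 3).

Definition cshift (c m f : nat) : nat :=
  iter m (fun f => csub (kid c 0, kid c 0, kid c 1, kid c 2) f) f.

Definition czero (m n : nat) : nat := cmk m n (fun _ _ => 0).

Definition ctraj (c m : nat) : nat :=
  iter m (fun x => cadd (kid c 0) 1 (cmul (kid c 0) (kid c 0) 1 (kid c 1) x) (kid c 2))
    (czero (kid c 0) 1).

Definition cprogress (c m : nat) : nat :=
  csub ((kid c 0).+1, kid c 0,
        cmk (kid c 0) (kid c 0).+1
          (fun i j => if j == 0%N then ent (ctraj c m) i 0
                     else Posz (nat_of_bool (i == j.-1))),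
        czero (kid c 0) 1)
    (cshift c m (cprefix c m)).

Definition cneg (n : nat) : nat :=
  code_seq [:: 0; cmk 1 n.+1 (fun _ j => Posz (nat_of_bool (j == 0))); code_int 1]%N.

Definition cwnt (c m : nat) : nat :=
  code_seq [:: 2; cprefix c m;
    code_seq [:: 5; code_seq [:: 3; cneg (kid c 0); cprogress c m]]]%N.

(** The iteration starts at [A], so this codes [A^(y+1)] and the search skips exponent [0]. *)
Definition cpow (c y : nat) : nat :=
  iter y (fun P => cmul (kid c 0) (kid c 0) (kid c 0) (kid c 1) P) (kid c 1).

Definition not_idem (c y : nat) : bool :=
  ~~ (cmul (kid c 0) (kid c 0) (kid c 0) (cpow c y) (cpow c y) == cpow c y).

Definition cvcons (n k e : nat) : nat :=
  cmk n.+1 1 (fun i _ => if i == 0%N then Posz k else ent e i.-1 0).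

Definition cprec (c m : nat) : nat := (cprefix c m + cprogress c m).+1.

(** The number [e] also bounds the entries of the vector it codes, so [beta] at [e] bounds the
    values of [k] to be tried. *)
Definition cuniv (c m e : nat) : bool :=
  ~~ (ceval (kid c 0, e) (cprefix c m) == 0%N) &&
  ~~ bex (beta (kid c 0) (cprec c m) e).+1
       (fun k => ceval ((kid c 0).+1, cvcons (kid c 0) k e) (cprogress c m) == 0%N).

(** The code of a column with all entries coded by [2B + 1], which exceeds the code of every integer
    of absolute value at most [B]; pairing is monotone. *)
Definition code_bound (n B : nat) : nat :=
  iter n (fun c => (code_pair (code_seq [:: B.*2.+1]) c).+1) 0%N.

Definition cnonempty (c m : nat) : bool :=
  bex (code_bound (kid c 0) (box (precision (cprec c m) (kid c 0)) (kid c 0))).+1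
    (cuniv c m).

Section CompWnt.
Context (X : Type) {eX : Enc X} (c m : X -> nat) (cc : computable c) (cm : computable m).

Lemma comp_cprefix : computable (fun x => cprefix (c x) (m x)).
Proof. by rewrite /cprefix; comp_solve. Qed.

Lemma comp_ctraj : computable (fun x => ctraj (c x) (m x)).
Proof. by rewrite /ctraj /czero; comp_solve. Qed.

Lemma comp_cprogress : computable (fun x => cprogress (c x) (m x)).
Proof.
have c1 := comp_cprefix; have c2 := comp_ctraj.
rewrite /cprogress /cshift /czero; comp_solve.
exact: (comp_comp c2 (comp_fst (comp_fst (@comp_id _ _)))).
Qed.

Lemma comp_cwnt : computable (fun x => cwnt (c x) (m x)).
Proof.
have c1 := comp_cprefix; have c2 := comp_cprogress.
by rewrite /cwnt /cneg; comp_solve.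
Qed.

Lemma comp_cprec : computable (fun x => cprec (c x) (m x)).
Proof.
by have c1 := comp_cprefix; have c2 := comp_cprogress; rewrite /cprec; comp_solve.
Qed.

Lemma comp_not_idem : computable (fun x => not_idem (c x) (m x)).
Proof. by rewrite /not_idem /cpow; comp_solve. Qed.

End CompWnt.

Lemma comp_cuniv X {eX : Enc X} (c m e : X -> nat) :
  computable c -> computable m -> computable e ->
  computable (fun x => cuniv (c x) (m x) (e x)).
Proof.
move=> cc cm ce; have c1 := comp_cprefix cc cm; have c2 := comp_cprec cc cm.
have c3 := comp_cprogress cc cm; rewrite /cuniv /cvcons; comp_solve.
exact: (comp_comp c3 (comp_fst (@comp_id _ _))).
Qed.

Lemma comp_cnonempty X {eX : Enc X} (c m : X -> nat) :
  computable c -> computable m -> computable (fun x => cnonempty (c x) (m x)).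
Proof.
move=> cc cm; have c1 := comp_cprec cc cm.
have cN : computable (fun x : X => kid (c x) 0) by comp_solve.
have cb := comp_box c1 cN; rewrite /cnonempty /code_bound.
have cb2 := comp_ext (fun x => addnn _) (comp_add cb cb).
comp_solve; last by apply: comp_cuniv; comp_solve.
exact: (comp_comp cb2 (comp_fst (@comp_id _ _))).
Qed.

(** * Correctness of the functions on codes *)

Section Correct.
Variables (N : nat) (R : affine N) (m : nat).
Let A := amat R.
Let b := avec R.
Let g := guard R.
Let c := code_affine R.

Lemma kid_affine : [/\ kid c 0 = N, kid c 1 = code_mx A, kid c 2 = code_mx b
                     & kid c 3 = code_pform g].
Proof. by rewrite /c /code_affine !kid_code. Qed.

Lemma cprefixE : cprefix c m = code_pform (prefixf A b m g).
Proof.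
have [c0 c1 c2 c3] := kid_affine; rewrite /cprefix c0 c1 c2 c3.
elim: m => // k ih; rewrite !iterS ih csubE //.
exact: (qfree_prefixf _ _ _ (guard_qfree R)).
Qed.

Lemma cshiftE f : qfree f -> cshift c m (code_pform f) = code_pform (shiftf A b m f).
Proof.
have [c0 c1 c2 c3] := kid_affine; rewrite /cshift c0 c1 c2 => qf.
by elim: m => // k ih; rewrite !iterS ih csubE //; exact: qfree_shiftf.
Qed.

Lemma czeroE p q : czero p q = code_mx (0 : 'M[int]_(p, q)).
Proof. by apply: cmkE => i j; rewrite mxE. Qed.

Lemma ctrajE : ctraj c m = code_mx (traj A b m 0).
Proof.
have [c0 c1 c2 c3] := kid_affine; rewrite /ctraj c0 c1 c2 czeroE.
by elim: m => // k ih; rewrite !iterS ih cmulE caddE.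
Qed.

Lemma cprogressE : cprogress c m = code_pform (progressf A b m g).
Proof.
have [c0 c1 c2 c3] := kid_affine; have qg := guard_qfree R.
rewrite /cprogress cprefixE cshiftE ?qfree_prefixf // c0 czeroE /progressf.
rewrite ctrajE -csubE ?qfree_shiftf ?qfree_prefixf //; congr (csub (_, _, _, _) _).
apply: cmkE => i j; case: (splitP (j : 'I_(1 + N))) => k jk.
  rewrite jk ord1 /= (ent_code_mx _ i 0).
  have -> : j = lshift N (0 : 'I_1) by apply: val_inj; rewrite /= jk ord1.
  exact: esym (row_mxEl _ _ _ _).
rewrite jk /=.
have -> : j = rshift 1 k by exact: val_inj.
by apply: esym; apply: etrans (row_mxEr _ _ _ _) _; rewrite mxE add0n -val_eqE natz.
Qed.

Lemma cwntE : cwnt c m = code_pform (wntf A b m g).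
Proof.
have [c0 c1 c2 c3] := kid_affine; rewrite /cwnt cprefixE cprogressE c0.
suff -> : cneg N = code_pform (PLe0 (neg_lterm N)) by [].
rewrite /cneg (_ : cmk _ _ _ = code_mx (delta_mx 0 0 : 'M[int]_(1, N.+1))) //.
by apply: cmkE => i j; rewrite mxE ord1 eqxx natz.
Qed.

Lemma cpowE : cpow c m = code_mx (A ^+ m.+1).
Proof.
have [c0 c1 c2 c3] := kid_affine; rewrite /cpow c0 c1.
by elim: m => [|k ih]; rewrite ?iterS ?ih ?cmulE ?expr1 // [in RHS]exprS.
Qed.

Lemma code_mx_inj p q : injective (@code_mx p q).
Proof. by move=> M M' e; apply/matrixP => i j; rewrite -!ent_code_mx e. Qed.

Lemma not_idemE : not_idem c m = (A ^+ (m.+1 + m.+1) != A ^+ m.+1).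
Proof.
have [c0 c1 c2 c3] := kid_affine; rewrite /not_idem cpowE c0 cmulE; congr (~~ _).
rewrite exprD; exact: (inj_eq (@code_mx_inj N N)).
Qed.

Lemma cvec_cvcons k e : cvec N.+1 (cvcons N k e) = vcons k%:Z (cvec N e).
Proof.
apply/colP => i; rewrite mxE ent_cmk //.
case: (unliftP 0 i) => [j|] ->; last by rewrite vcons0.
by rewrite vconsS mxE.
Qed.

Lemma code_boundP (v : 'cV[int]_N) B :
  (forall i, (`|(v i 0)%R| <= B)%N) -> (code_mx v <= code_bound N B)%N.
Proof.
move=> hv; rewrite /code_mx.
have -> : code_bound N B = code_bound (size (enum 'I_N)) B by rewrite size_enum_ord.
elim: (enum 'I_N) => // i s ih; rewrite /code_bound iterS -/(code_bound _ _) ltnS.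
apply: leq_pair ih; rewrite enum_ordSl (size0nil (size_enum_ord 0)) /= ltnS.
apply: leq_pair => //; have := hv i; case: (v i _) => n /=; lia.
Qed.

Hypothesis m_gt0 : (0 < m)%N.
Hypothesis idem : A ^+ (m + m) = A ^+ m.

Let H := prefixf A b m g.
Let K := progressf A b m g.

Lemma wnt_univ_sat v : wnt R v <-> univ_sat H K v.
Proof.
have qg := guard_qfree R.
have -> : wnt R v = sat (wntf A b m g) v by rewrite (wntf_defines m_gt0 idem).
split=> -[Hv Kv]; split=> //; [move=> k | move=> z].
  by have := Kv k; rewrite /= neg_ltermE; case=> //; lia.
rewrite /= neg_ltermE; case: z => k; last by left; lia.
by right; exact: Kv.
Qed.

(** Both bounded searches are exact: a solution can be moved into the box, whose vectors have codes
    at most [code_bound], and for each candidate finitely many [k] decide the universal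
    condition. *)
Lemma cnonemptyP : cnonempty c m <-> exists v, wnt R v.
Proof.
have [c0 c1 c2 c3] := kid_affine; have qg := guard_qfree R.
have qH : qfree H by exact: qfree_prefixf.
have qK : qfree K by exact/qfree_psub/qfree_shiftf.
set M := cprec c m; have ME : M = (code_pform H + code_pform K).+1.
  by rewrite /M /cprec cprefixE cprogressE.
have le_H : (code_pform H <= M)%N by rewrite ME; lia.
have le_K : (code_pform K <= M)%N by rewrite ME; lia.
have M_gt0 : (0 < M)%N by rewrite ME.
have cunivP e : cuniv c m e <-> univ_sat H K (cvec N e).
  have be i : (`|(cvec N e i 0)%R| <= e)%N by rewrite mxE leq_ent.
  rewrite (univ_sat_bounded qH qK le_H le_K M_gt0 be).
  rewrite /cuniv -/M c0 cprefixE cprogressE cevalE //.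
  split=> [/andP[h1 h2]|[h1 h2]].
    split; first by move: h1; case: asboolP.
    move=> k le_k; apply: contrapT => nk; case/negP: h2; apply/bexP; exists k => //.
    by rewrite cevalE // cvec_cvcons; case: asboolP.
  rewrite asboolT // andTb; apply/bexP => -[k lt_k].
  by rewrite cevalE // cvec_cvcons asboolT //; exact: h2.
rewrite /cnonempty -/M c0; split=> [/bexP[e _ /cunivP h]|[v /wnt_univ_sat sv]].
  by exists (cvec N e); apply/wnt_univ_sat.
have [v' sv' bv'] := univ_sat_small qH qK le_H le_K M_gt0 sv.
apply/bexP; exists (code_mx v'); first by rewrite ltnS; exact: code_boundP.
by apply/cunivP; rewrite cvec_code.
Qed.

End Correct.

(* [RMin] serves only here: no computable bound on the period is needed. *)
Lemma computes_search (T : nat -> nat -> bool) (G : nat -> nat -> nat) :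
  computable (fun z => T z.1 z.2) -> computable (fun z => G z.1 z.2) ->
  exists p : recfun 1, forall c, (exists y, ~~ T c y) ->
    exists2 y, ~~ T c y & computes p [tuple c] (G c y).
Proof.
have curry (F : nat -> nat -> nat) : computable (fun z => F z.1 z.2) -> nfun2 F.
  move=> [f cf hf]; apply: nfun_ext (nfun1_comp cf nfun2_pair) => v.
  exact: (hf (_, _)).
move=> cT /curry[q hq].
(* Arguments are swapped because minimization runs over the first one. *)
have [t ht] : nfun2 (fun y c => nat_of_bool (T c y)).
  by apply/nfun2_swap/curry; exact: comp_bool_nat.
exists (RComp q (fun i : 'I_2 => if i == 0 then RProj ord0 else RMin t)) => c exT.
case: (ex_minnP exT) => y Ty y_min; exists y => //=.
exists [tuple c; y]; split; last exact: (hq [tuple c; y]).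
case=> [[|[|//]]] lt_i /=; first by rewrite (tnth_nth 0%N).
rewrite (tnth_nth 0%N) /=; split.
  by have := ht [tuple y; c]; rewrite /= (negbTE Ty).
(* Below the least [y] the test holds and has value [1], the successor of [0]. *)
move=> k lt_ky; exists 0%N; have := ht [tuple k; c]; rewrite /=.
by case: (boolP (T c k)) => // /y_min; rewrite leqNgt lt_ky.
Qed.

(** * Computation of the formula and decision of termination *)

Lemma not_idem_search N (R : affine N) : finite_monoid R ->
  exists y, ~~ not_idem (code_affine R) y.
Proof.
by move=> /finite_monoid_idem[y idem]; exists y; rewrite not_idemE negbK idem.
Qed.

Local Close Scope ring_scope.
Local Open Scope classical_set_scope.

Theorem theorem5p6 :
  (forall (N : nat) (R : affine N), finite_monoid R ->
     exists F : pform N, defines F (wnt R))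
  /\
  (exists p : recfun 1, forall (N : nat) (R : affine N), finite_monoid R ->
     exists F : pform N,
       computes p [tuple code_affine R] (code_pform F) /\ defines F (wnt R))
  /\
  (exists d : recfun 1, forall (N : nat) (R : affine N), finite_monoid R ->
     exists b : bool,
       computes d [tuple code_affine R] (nat_of_bool b) /\
       (b = true <-> wnt R = set0)).
Proof.
have cT : computable (fun z : nat * nat => not_idem z.1 z.2).
  by apply: comp_not_idem; comp_solve.
have idemP N (R : affine N) y : ~~ not_idem (code_affine R) y ->
    (amat R ^+ (y.+1 + y.+1) = amat R ^+ y.+1)%R.
  by rewrite not_idemE negbK => /eqP.
split; [|split].
- by move=> N R /finite_monoid_idem[y idem]; eexists; exact: wntf_defines idem.
(* The search variable [y] stands for the positive exponent [y + 1]; idempotence of that power is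
   all that correctness requires of it. *)
- have [|p hp] := computes_search cT (G := fun c y => cwnt c y.+1).
    by apply: comp_cwnt; comp_solve.
  exists p => N R /not_idem_search/hp[y /idemP idem py].
  exists (wntf (amat R) (avec R) y.+1 (guard R)).
  by rewrite -cwntE; split=> //; exact: wntf_defines.
- have [|d hd] := computes_search cT (G := fun c y => nat_of_bool (~~ cnonempty c y.+1)).
    by apply: comp_bool_nat; apply: comp_neg; apply: comp_cnonempty; comp_solve.
  exists d => N R /not_idem_search/hd[y /idemP idem dy].
  exists (~~ cnonempty (code_affine R) y.+1); split=> //.
  have nonempty := cnonemptyP (ltn0Sn y) idem.
  split=> [/negP empty|R0].
    by apply/seteqP; split=> // v Rv; case: empty; apply/nonempty; exists v.
  by apply/negP => /nonempty[v]; rewrite R0.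
Qed.
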